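(* Let $d,b,k,n\in\{1,2,3,\ldots\}$ and $0<\delta\le 1$. There exists an estimator $V_n\in\mathcal{D}_d$ (a function of the sample $X_1,\ldots,X_n$, not depending on the sampling density) such that, for any density $p\in\mathcal{D}_d$ with NL-spectrum $(w,L)$, if $X_1,\ldots,X_n$ are i.i.d. with density $p$, then $$P\left(\|p-V_n\|_1>\frac{\sqrt{3}\,d}{2b}\sum_{i=1}^k w_iL_i+6\sum_{i=k+1}^\infty w_i+7\sqrt{\frac{2bdk\log(4bdkn)}{n}}+7\sqrt{\frac{\log(3/\delta)}{2n}}\right)<\delta .$$
   Context: A pdf on $\mathbb{R}^d$ is an a.e. non-negative function on $\mathbb{R}^d$ with Lebesgue integral equal to one; equalities of functions mean equality Lebesgue-a.e. $\mathcal{D}_d$ is the set of all pdfs whose support is contained in the unit cube $[0,1]^d$. $\|\cdot\|_1$ is the $L^1$ norm with respect to Lebesgue measure. An estimator in $\mathcal{D}_d$ is a (measurable) map from samples $(X_1,\ldots,X_n)$ to $\mathcal{D}_d$. For functions $f_1,\ldots,f_d:\mathbb{R}\to\mathbb{R}$, $\prod_{j=1}^d f_j$ denotes $(x_1,\ldots,x_d)\mapsto f_1(x_1)\cdots f_d(x_d)$. Definition. A pdf $p$ on $\mathbb{R}^d$ has a non-negative Lipschitz spectrum (NL-spectrum) $(w,L)$, with $w=(w_i)_{i=1}^\infty$ and $L=(L_i)_{i=1}^\infty$, if $$p=\sum_{i=1}^\infty w_i\prod_{j=1}^d p_{i,j},$$ where $(w_i)_{i=1}^\infty$ is a non-negative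 sequence with $\sum_{i=1}^\infty w_i=1$ and $w_1>0$, and the $p_{i,j}$ ($i\ge1$, $1\le j\le d$) are Lipschitz continuous pdfs on $\mathbb{R}$ with Lipschitz constant $L_i$, i.e. $|p_{i,j}(x)-p_{i,j}(y)|\le L_i|x-y|$ for all $x,y\in\mathbb{R}$. *)

(* Defs.v *)
From HB Require Import structures.
From mathcomp Require Import all_boot all_order all_algebra.
From mathcomp Require Import all_classical all_reals all_analysis.

Set Implicit Arguments.
Unset Strict Implicit.
Unset Printing Implicit Defensive.

Import Order.TTheory GRing.Theory Num.Theory.
Import numFieldNormedType.Exports.

Local Open Scope classical_set_scope.
Local Open Scope ring_scope.

(* [measurableTypeR R] is R with the Borel sigma-algebra, in the form on which
   [lebesgue_measure] is defined; tuples carry the product sigma-algebra. *)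
Notation Rd R d := (d.-tuple (measurableTypeR R)) (only parsing).

Section cons_measure.
Context (dT : measure_display) (T : measurableType dT) (n : nat) (R : realType).
Variables (m1 : {sigma_finite_measure set T -> \bar R})
  (m2 : {sigma_finite_measure set (n.-tuple T) -> \bar R}).

Definition cons_pair (x : T * n.-tuple T) : n.+1.-tuple T :=
  [tuple of x.1 :: x.2].

Lemma measurable_cons_pair : measurable_fun [set: T * n.-tuple T] cons_pair.
Proof. exact: measurable_cons. Qed.

Let split_tuple (t : n.+1.-tuple T) : T * n.-tuple T :=
  (tnth t ord0, [tuple of behead t]).

Let measurable_split_tuple : measurable_fun [set: n.+1.-tuple T] split_tuple.
Proof.
apply/measurable_fun_prod; first exact: measurable_tnth.
exact: measurable_behead.
Qed.

Let split_tupleK : cancel split_tuple cons_pair.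
Proof. by move=> t; rewrite /cons_pair /split_tuple -tuple_eta. Qed.

Let cons_pairK : cancel cons_pair split_tuple.
Proof.
move=> [x t]; rewrite /cons_pair /split_tuple; congr pair => //.
exact: val_inj.
Qed.

Definition cons_measure : set (n.+1.-tuple T) -> \bar R :=
  pushforward (m1 \x m2)%E cons_pair.

Let cons_measure0 : cons_measure set0 = 0%E.
Proof. by rewrite /cons_measure /pushforward preimage_set0 measure0. Qed.

Let cons_measure_ge0 A : (0 <= cons_measure A)%E.
Proof. by rewrite /cons_measure /pushforward measure_ge0. Qed.

Let cons_measure_sigma_additive : semi_sigma_additive cons_measure.
Proof.
move=> F mF tF mUF; rewrite /cons_measure /pushforward preimage_bigcup.
apply: measure_semi_sigma_additive.
- by move=> i; rewrite -[X in measurable X]setTI; exact: measurable_cons_pair.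
- apply/trivIsetP => /= i j _ _ ij; rewrite -preimage_setI.
  by move/trivIsetP : tF => /(_ _ _ _ _ ij) ->//; rewrite preimage_set0.
- rewrite -preimage_bigcup -[X in measurable X]setTI.
  exact: measurable_cons_pair.
Qed.

HB.instance Definition _ := isMeasure.Build _ _ _ cons_measure
  cons_measure0 cons_measure_ge0 cons_measure_sigma_additive.

Let cons_measure_sigma_finite : sigma_finite setT cons_measure.
Proof.
have /sigma_finiteP[F [TF ndF Foo]] := sigma_finiteT m1.
have /sigma_finiteP[G [TG ndG Goo]] := sigma_finiteT m2.
have mFG i : measurable (F i `*` G i).
  by have [? _] := Foo i; have [? _] := Goo i; exact: measurableX.
exists (fun i => split_tuple @^-1` (F i `*` G i)).
  apply/esym; rewrite -subTset => t _.
  have [i _ Fi] : (\bigcup_i F i) (tnth t ord0) by rewrite -TF.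
  have [j _ Gj] : (\bigcup_i G i) [tuple of behead t] by rewrite -TG.
  exists (maxn i j) => //; split.
    by have /subsetPset := ndF _ _ (leq_maxl i j); apply.
  by have /subsetPset := ndG _ _ (leq_maxr i j); apply.
move=> i; split.
  by rewrite -[X in measurable X]setTI; exact: measurable_split_tuple.
rewrite /cons_measure /pushforward -comp_preimage.
rewrite (_ : split_tuple \o cons_pair = id); last exact/funext.
have [? ?] := Foo i; have [? ?] := Goo i.
by rewrite preimage_id product_measure1E// lte_mul_pinfty// ge0_fin_numE.
Qed.

HB.instance Definition _ := Measure_isSigmaFinite.Build _ _ _
  cons_measure cons_measure_sigma_finite.

End cons_measure.

(* d-dimensional Lebesgue measure, as a d-fold product; the point mass for
   d = 0. *)
Fixpoint lebesgue_measure_nd (R : realType) (d : nat) :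
    {sigma_finite_measure set (Rd R d) -> \bar R} :=
  match d with
  | 0%N => \d_([tuple] : Rd R 0)
  | e.+1 => cons_measure (@lebesgue_measure R) (lebesgue_measure_nd R e)
  end.

Lemma lebesgue_measure_nd_box (R : realType) (d : nat)
    (A : 'I_d -> set (measurableTypeR R)) : (forall j, measurable (A j)) ->
  lebesgue_measure_nd R d [set x | forall j, A j (tnth x j)] =
  (\prod_(j < d) lebesgue_measure (A j))%E.
Proof.
elim: d A => [|d IH] A mA.
  rewrite big_ord0 /= (_ : [set _ | _] = setT) ?diracT//.
  by apply/seteqP; split=> // x _ [].
rewrite big_ord_recl -IH//= /cons_measure /pushforward.
rewrite -product_measure1E//; last first.
  rewrite (_ : [set _ | _] = \bigcap_(j in [set: 'I_d])
     ((fun x : Rd R d => tnth x j) @^-1` A (lift ord0 j))); last first.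
    by apply/seteqP; split=> x h j; [move=> _; exact: h|exact: h].
  apply: fin_bigcap_measurable => // j _.
  by rewrite -[X in measurable X]setTI; exact: measurable_tnth.
congr (_ _); apply/seteqP; split=> -[x t] /=.
  move=> h; split; first exact: (h ord0).
  by move=> j; have := h (lift ord0 j); rewrite tnthS.
move=> [h0 h] j; case: (unliftP ord0 j) => [i|] ->; last by rewrite tnth0.
by rewrite tnthS.
Qed.

Definition is_pdf (dT : measure_display) (T : measurableType dT) (R : realType)
    (mu : {measure set T -> \bar R}) (f : T -> R) : Prop :=
  [/\ measurable_fun [set: T] f,
      {ae mu, forall x, 0 <= f x} &
      (\int[mu]_x (f x)%:E = 1)%E].

Definition unit_cube (R : realType) (d : nat) : set (Rd R d) :=
  [set x | forall j, 0 <= tnth x j <= 1].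

(* As densities are taken up to a.e. equality and the cube is closed, "support
   contained in the cube" means vanishing a.e. off the cube. *)
Definition cube_pdf (R : realType) (d : nat) (p : Rd R d -> R) : Prop :=
  is_pdf (lebesgue_measure_nd R d) p /\
  {ae lebesgue_measure_nd R d, forall x, ~ unit_cube x -> p x = 0}.

(* Sequences are indexed from 0: [w i] and [L i] are w_(i+1) and L_(i+1). *)
Definition NL_spectrum (R : realType) (d : nat) (p : Rd R d -> R)
    (w L : nat -> R) : Prop :=
  [/\ forall i, 0 <= w i, (\sum_(0 <= i <oo) (w i)%:E = 1)%E, 0 < w 0%N &
      exists q : nat -> 'I_d -> measurableTypeR R -> R,
        (forall i j, is_pdf (@lebesgue_measure R) (q i j) /\
                     (L i).-lipschitz (q i j : R -> R)) /\
        {ae lebesgue_measure_nd R d, forall x,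
          (p x)%:E =
          (\sum_(0 <= i <oo) (w i * \prod_(j < d) q i j (tnth x j))%:E)%E}].

(* Joint measurability in (sample, point) is what makes L1 distances to the
   estimate measurable functions of the sample. *)
Definition estimator (R : realType) (d n : nat)
    (V : n.-tuple (Rd R d) -> Rd R d -> R) : Prop :=
  measurable_fun [set: n.-tuple (Rd R d) * Rd R d] (fun z => V z.1 z.2) /\
  forall s, cube_pdf (V s).

Definition mutually_independent (dO dT : measure_display)
    (Omega : measurableType dO) (T : measurableType dT) (R : realType)
    (P : probability Omega R) (n : nat) (X : 'I_n -> {RV P >-> T}) : Prop :=
  forall (J : {set 'I_n}) (A : 'I_n -> set T), (forall i, measurable (A i)) ->
    P (\bigcap_(i in [set` J]) (X i @^-1` A i)) =
    (\prod_(i in J) P (X i @^-1` A i))%E.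

Definition iid_with_density (dO : measure_display) (Omega : measurableType dO)
    (R : realType) (d n : nat) (P : probability Omega R)
    (X : 'I_n -> {RV P >-> Rd R d}) (p : Rd R d -> R) : Prop :=
  mutually_independent X /\
  forall (i : 'I_n) (A : set (Rd R d)), measurable A ->
    distribution P (X i) A = (\int[lebesgue_measure_nd R d]_(x in A) (p x)%:E)%E.

Definition L1_dist (R : realType) (d : nat) (f g : Rd R d -> R) : \bar R :=
  'N[lebesgue_measure_nd R d]_1[(fun x => (f x - g x)%:E)]%E.

(* Main.v *)
Require Import Defs.
From mathcomp Require Import all_boot all_order all_algebra.
From mathcomp Require Import all_classical all_reals all_analysis.
From mathcomp Require Import measurable_realfun ring lra.
Import Order.TTheory GRing.Theory Num.Theory.
Import numFieldNormedType.Exports.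
Local Open Scope classical_set_scope.
Local Open Scope ring_scope.

Set Implicit Arguments.
Unset Strict Implicit.
Unset Printing Implicit Defensive.

(* The estimator is the minimum distance estimate over a finite L1-cover of the
   k-component mixtures of product histograms with b bins per coordinate.
   - Any pdf p satisfies ||p - f*|| <= 3 min_c ||p - f_c|| + 4 eps, where f* is
     chosen among the candidates f_c so as to minimize the largest deviation
     between model mass and empirical mass over the Scheffe sets {f_a > f_b},
     and eps bounds |P(A) - P_n(A)| over these sets.
   - On each bin an L-Lipschitz density deviates from its mean by at most
     L / (2 sqrt 3 b) on average, so truncating the spectrum at k, renormalizing
     the weights and binning each factor costs at most
     2 sum_{i > k} w_i + d / (2 sqrt 3 b) sum_{i <= k} w_i L_i.
   - Cutting the parameter cube into cells of side 1 / (4bdkn) gives at most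
     (4bdkn)^(2bdk) candidates and an additional error at most 1 / (2n).
   - The tail bound 2 exp(- n eps^2) for empirical masses, weaker than
     Hoeffding's 2 exp(- 2 n eps^2), already fits in the constants 7. *)

(** * Concentration of empirical masses *)

(** By evenness take x >= 0. The product [g] of the left side with exp(- y^2 / 2) is nonincreasing
    on the half-line, since its derivative has the sign of [h], and [h] is nonincreasing with h(0) =
    0. Comparing with g(0) = 2 concludes. *)
Lemma cosh_le_gauss (R : realType) (x : R) :
  expR x + expR (- x) <= 2 * expR (x ^+ 2 / 2).
Proof.
wlog x0 : x / 0 <= x => [hw|].
  have [/hw//|/ltW x0] := leP 0 x.
  by have := hw (- x); rewrite opprK sqrrN oppr_ge0 addrC; exact.
pose h (y : R) := (1 - y) * expR y - (1 + y) * expR (- y).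
pose g (y : R) := expR (y - y ^+ 2 / 2) + expR (- y - y ^+ 2 / 2).
have dh (y : R) : is_derive y 1 h (y * (expR (- y) - expR y)).
  rewrite /h; apply: is_derive_eq; rewrite /GRing.scale/=. ring.
have dg (y : R) : is_derive y 1 g (h y * expR (- (y ^+ 2 / 2))).
  rewrite /g /h; apply: is_derive_eq.
by rewrite !expRD /GRing.scale/=; field.
have h0 (y : R) : 0 <= y -> h y <= 0.
  move=> y0; have -> : 0 = h 0 by rewrite /h oppr0 expR0; ring.
  apply: (@ler0_derive1_nincry _ h 0) => //.
  - by move=> z; rewrite in_itv/= andbT => z0; rewrite derive1E derive_val;
      rewrite mulr_ge0_le0 ?(ltW z0)// subr_le0 ler_expR; lra.
  - by apply: continuous_subspaceT => z; apply/differentiable_continuous/derivable1_diffP.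
have : g x <= g 0.
  apply: (@ler0_derive1_nincry _ g 0) => //.
  - by move=> z; rewrite in_itv/= andbT => z0; rewrite derive1E derive_val;
      rewrite mulr_le0_ge0 ?expR_ge0// h0// ltW.
  - by apply: continuous_subspaceT => z; apply/differentiable_continuous/derivable1_diffP.
rewrite {2}/g expr0n/= mul0r oppr0 addr0 expR0 /g !expRD -mulrDl (expRN (_ / 2)).
by rewrite ler_pdivrMr ?expR_gt0.
Qed.

(* Symmetrization: if Y' is an independent copy of Y, then
   E exp(l (Y - q)) <= E exp(l (Y - Y')) by Jensen. *)
Lemma bernoulli_mgf_le (R : realType) (q l : R) : 0 <= q <= 1 ->
  q * expR (l * (1 - q)) + (1 - q) * expR (l * - q) <= expR (l ^+ 2 / 4).
Proof.
move=> /andP[q0 q1].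
pose m (t : R) := q * expR (t * (1 - q)) + (1 - q) * expR (t * - q).
(* Jensen for the centered variable, here from exp(x) >= 1 + x; it yields m(l) <= m(l) m(-l). *)
have m1 t : 1 <= m t.
  have := expR_ge1Dx (t * (1 - q)); have := expR_ge1Dx (t * - q).
  rewrite /m; nra.
(* This product is E exp(l (Y - Y')), where Y - Y' takes each of the values 1 and -1 with
   probability q (1 - q). *)
have mm : m l * m (- l) = 1 + q * (1 - q) * (expR l + expR (- l) - 2).
  have e (s t u : R) : s + t = u -> expR s * expR t = expR u by move=> <-; rewrite expRD.
  have e1 : expR (l * (1 - q)) * expR (- l * (1 - q)) = 1.
    by rewrite (e _ _ 0) ?expR0//; ring.
  have e2 : expR (l * - q) * expR (- l * - q) = 1.
    by rewrite (e _ _ 0) ?expR0//; ring.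
  have e3 : expR (l * (1 - q)) * expR (- l * - q) = expR l by apply: e; ring.
  have e4 : expR (l * - q) * expR (- l * (1 - q)) = expR (- l) by apply: e; ring.
  rewrite /m.
  transitivity (q * q * (expR (l * (1 - q)) * expR (- l * (1 - q)))
    + q * (1 - q) * (expR (l * (1 - q)) * expR (- l * - q))
    + ((1 - q) * q * (expR (l * - q) * expR (- l * (1 - q)))
    + (1 - q) * (1 - q) * (expR (l * - q) * expR (- l * - q)))); first by ring.
  by rewrite e1 e2 e3 e4; ring.
(* Passing to l / 2 turns exp(l) + exp(-l) - 2 into a square minus 4. Bounding that square by 4
   exp(l^2 / 4) and q (1 - q) by 1/4 makes the constants cancel exactly. *)
have c : expR l + expR (- l) = (expR (l / 2) + expR (- (l / 2))) ^+ 2 - 2.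
  rewrite sqrrD -!expRM_natl.
  have -> : expR (l / 2) * expR (- (l / 2)) = 1 by rewrite -expRD subrr expR0.
  rewrite (_ : 2 * (l / 2) = l); last by field.
  rewrite (_ : 2 * - (l / 2) = - l); last by field. ring.
have c2 : (expR (l / 2) + expR (- (l / 2))) ^+ 2 <= 4 * expR (l ^+ 2 / 4).
  apply: (@le_trans _ _ ((2 * expR ((l / 2) ^+ 2 / 2)) ^+ 2)).
    by rewrite lerXn2r ?nnegrE ?addr_ge0 ?mulr_ge0 ?expR_ge0// cosh_le_gauss.
  rewrite exprMn -expRM_natl -natrX ler_pM2l//.
  by rewrite (_ : 2%:R * _ = l ^+ 2 / 4) //; field.
have c3 : 2 <= expR l + expR (- l).
  by have := expR_ge1Dx l; have := expR_ge1Dx (- l); lra.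
have qq : q * (1 - q) <= 1 / 4 by have := sqr_ge0 (q - 1 / 2); nra.
have := m1 l; have := m1 (- l); rewrite -/(m l) => m1' m1l.
apply: (@le_trans _ _ (m l * m (- l))); first by rewrite ler_peMr//; lra.
rewrite mm; nra.
Qed.

(** Chernoff's method, carried out on the finite space of success patterns: once the indicator of
    the tail is bounded by an exponential, the sum over patterns factorizes into n copies of a
    Bernoulli moment generating function. *)
Lemma binomial_upper_tail (R : realType) (n : nat) (q eps : R) :
  0 <= q <= 1 -> 0 <= eps ->
  \sum_(s : {ffun 'I_n -> bool} | n%:R * eps <= \sum_i ((s i)%:R - q))
    \prod_i (if s i then q else 1 - q) <= expR (- (n%:R * eps ^+ 2)).
Proof.
move=> /[dup] q01 /andP[q0 q1] e0.
(* This value minimizes the resulting exponent n (l^2 / 4 - l eps). *)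
pose l := 2 * eps.
have w0 (s : {ffun 'I_n -> bool}) : 0 <= \prod_i (if s i then q else 1 - q).
  by apply: prodr_ge0 => i _; case: ifP => _; lra.
apply: (@le_trans _ _ (\sum_(s : {ffun 'I_n -> bool})
   expR (- (l * (n%:R * eps))) *
   \prod_i ((if s i then q else 1 - q) * expR (l * ((s i)%:R - q))))).
  rewrite big_mkcond; apply: ler_sum => s _; rewrite [X in _ <= _ * X]big_split/=.
  rewrite -expR_sum -mulr_sumr mulrCA -expRD (addrC (- _)) -mulrBr.
  case: ifPn => [h|_]; last by rewrite mulr_ge0 ?expR_ge0.
  rewrite ler_peMr//; apply: le_trans (expR_ge1Dx _).
  by rewrite lerDl; apply: mulr_ge0; rewrite ?subr_ge0// mulr_ge0.
rewrite -mulr_sumr -(bigA_distr_bigA (fun (_ : 'I_n) (c : bool) =>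
  (if c then q else 1 - q) * expR (l * (c%:R - q)))).
under eq_bigr do rewrite big_bool /= sub0r.
rewrite prodr_const card_ord.
apply: (@le_trans _ _ (expR (- (l * (n%:R * eps))) * expR (l ^+ 2 / 4) ^+ n)).
  rewrite ler_pM2l ?expR_gt0// lerXn2r ?nnegrE ?expR_ge0//.
    by rewrite addr_ge0 ?mulr_ge0 ?expR_ge0//; lra.
  exact: bernoulli_mgf_le.
rewrite -expRM_natl -expRD ler_expR /l le_eqVlt; apply/orP; left; apply/eqP; by field.
Qed.

Lemma measurable_finite_data d (T : measurableType d) (F : finType) (data : T -> F)
    (Q : {pred F}) : (forall c, measurable [set x | data x = c]) ->
  measurable [set x | Q (data x)].
Proof.
move=> mdata.
rewrite (_ : [set x | _] = \bigcup_(c in [set c | Q c]) [set x | data x = c]).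
  by apply: fin_bigcup_measurable => //; exact: finite_finset.
by apply/seteqP; split=> [x Qx|x [c /[swap] <-]//]; exists (data x).
Qed.

Lemma measure_finite_data d (T : measurableType d) (R : realType)
    (mu : {measure set T -> \bar R}) (F : finType) (data : T -> F) (Q : {pred F}) :
  (forall c, measurable [set x | data x = c]) ->
  mu [set x | Q (data x)] = (\sum_(c | Q c) mu [set x | data x = c])%E.
Proof.
move=> mdata.
rewrite (_ : [set x | _] = \bigcup_(c in [set c | Q c]) [set x | data x = c]); last first.
  by apply/seteqP; split=> [x Qx|x [c /[swap] <-]//]; exists (data x).
have fQ : finite_set [set c | Q c] by exact: finite_finset.
rewrite measure_fin_bigcup//; last by move=> i j _ _ [x [<- <-]].
rewrite (_ : [set c | Q c] = [set` enum Q]); last first.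
  by apply/seteqP; split=> c /=; rewrite mem_enum.
by rewrite -fsbig_seq ?enum_uniq// big_enum.
Qed.

Section indicator_pattern.
Context dO dT (Omega : measurableType dO) (T : measurableType dT) (I : finType).
Variables (X : I -> Omega -> T) (A : I -> set T).

(** Events that depend on the observations only through hits and misses factor through this
    finite-valued statistic, which reduces their measurability and their probability to finite
    unions and sums. *)
Definition indicator_pattern (omega : Omega) : {ffun I -> bool} :=
  [ffun i => X i omega \in A i].

(** This exhibits each pattern as an intersection of events on single observations, the form to
    which [mutually_independent] applies. *)
Lemma indicator_patternE (s : {ffun I -> bool}) :
  [set omega | indicator_pattern omega = s] =
  \bigcap_(i in [set` [set: I]%SET]) (X i @^-1` (if s i then A i else ~` A i)).
Proof.
apply/seteqP; split=> [omega <- i _ /=|omega h].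
  by rewrite ffunE; case: ifPn => [/set_mem//|/negP h] /mem_set.
apply/ffunP => i; rewrite ffunE; have := h i; rewrite /= finset.in_setT => /(_ isT).
by rewrite /preimage /=; case: (s i) => Xi; [exact: mem_set|exact: memNset].
Qed.

Lemma measurable_indicator_pattern (s : {ffun I -> bool}) :
  (forall i, measurable_fun [set: Omega] (X i)) -> (forall i, measurable (A i)) ->
  measurable [set omega | indicator_pattern omega = s].
Proof.
move=> mX mA; rewrite indicator_patternE; apply: fin_bigcap_measurable => // i _.
rewrite -[X in measurable X]setTI; apply: mX => //.
by case: ifP => // _; exact: measurableC.
Qed.

End indicator_pattern.

Section hoeffding.
Context dO dT (Omega : measurableType dO) (T : measurableType dT) (R : realType).
Variables (P : probability Omega R) (n : nat) (X : 'I_n -> {RV P >-> T}).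
Hypothesis Xind : mutually_independent X.

Lemma measurable_indicator_sum (A : set T) (q : R) (Q : R -> bool) : measurable A ->
  measurable [set omega | Q (\sum_i (((X i omega \in A) : bool)%:R - q))].
Proof.
move=> mA; pose Q' (s : {ffun 'I_n -> bool}) := Q (\sum_i ((s i)%:R - q)).
rewrite (_ : [set omega | _] = [set omega | Q' (indicator_pattern X (fun=> A) omega)]); last first.
  apply/funext => omega; rewrite /Q' /=; congr (is_true (Q _)).
  by apply: eq_bigr => i _; rewrite ffunE.
by apply: measurable_finite_data => s; apply: measurable_indicator_pattern.
Qed.

Lemma empirical_upper_tail (A : set T) (q eps : R) :
  measurable A -> 0 <= eps -> 0 <= q <= 1 -> (forall i, P (X i @^-1` A) = q%:E) ->
  (P [set omega | n%:R * eps <= \sum_i (((X i omega \in A) : bool)%:R - q)]%R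
    <= (expR (- (n%:R * eps ^+ 2)))%:E)%E.
Proof.
move=> mA e0 q01 PA.
pose Q (s : {ffun 'I_n -> bool}) := n%:R * eps <= \sum_i ((s i)%:R - q).
rewrite (_ : [set omega | _] = [set omega | Q (indicator_pattern X (fun=> A) omega)]); last first.
  apply/funext => omega; rewrite /Q /=; congr (is_true (_ <= _)).
  by apply: eq_bigr => i _; rewrite ffunE.
rewrite measure_finite_data; last by move=> s; exact: measurable_indicator_pattern.
apply: (@le_trans _ _ (\sum_(s | Q s) \prod_i (if s i then q else 1 - q))%:E); last first.
  by rewrite lee_fin; exact: binomial_upper_tail q01 e0.
rewrite -sumEFin; apply: lee_sum => s _.
(* Independence is stated for arbitrary families of measurable sets, so hits and misses can be mixed
   freely. *)
have mAs i : measurable (if s i then A else ~` A).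
  by case: ifP => // _; exact: measurableC.
rewrite indicator_patternE [leLHS](Xind [set: 'I_n]%SET mAs).
rewrite -prodEFin le_eqVlt; apply/orP; left; apply/eqP.
apply: eq_big => [i|i _]; first by rewrite inE.
case: ifP => // _; rewrite preimage_setC probability_setC ?PA//.
by rewrite -[X in measurable X]setTI; exact: measurable_funP.
Qed.

Lemma hoeffding_empirical (A : set T) (q eps : R) :
  measurable A -> 0 <= eps -> 0 <= q <= 1 -> (forall i, P (X i @^-1` A) = q%:E) ->
  (P [set omega | n%:R * eps <= `|\sum_i (((X i omega \in A) : bool)%:R - q)|]%R
    <= (2 * expR (- (n%:R * eps ^+ 2)))%:E)%E.
Proof.
move=> mA e0 /[dup] q01 /andP[q0 q1] PA.
have mXA i : measurable (X i @^-1` A).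
  by rewrite -[X in measurable X]setTI; exact: measurable_funP.
(* The lower tail for A is the upper tail for its complement, of mass 1 - q. *)
have SC omega : - \sum_i ((X i omega \in A)%:R - q) =
    \sum_i ((X i omega \in ~` A)%:R - (1 - q)).
  rewrite -sumrN; apply: eq_bigr => i _; rewrite in_setC.
  by case: (_ \in A); rewrite /=; ring.
have mS := @measurable_indicator_sum A q _ mA.
apply: (@le_trans _ _ (P ([set omega | n%:R * eps <= \sum_i ((X i omega \in A)%:R - q)] `|`
    [set omega | n%:R * eps <= - \sum_i ((X i omega \in A)%:R - q)]))).
  apply: le_measure; rewrite ?inE; first exact: (mS (fun x => n%:R * eps <= `|x|)).
    apply: measurableU; first exact: (mS (fun x => n%:R * eps <= x)).
    exact: (mS (fun x => n%:R * eps <= - x)).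
  by move=> omega /=; rewrite ler_normr => /orP.
apply: le_trans (measureU2 _ _ _) _.
- exact: (mS (fun x => n%:R * eps <= x)).
- exact: (mS (fun x => n%:R * eps <= - x)).
rewrite mulr2n mulrDl mul1r [leRHS]EFinD.
apply: leeD; first exact: empirical_upper_tail.
under eq_set do rewrite SC.
apply: empirical_upper_tail => //; first exact: measurableC.
  by rewrite subr_ge0 q1 gerBl.
by move=> i; rewrite preimage_setC probability_setC; [rewrite [X in (1 - X)%E]PA|exact: mXA].
Qed.

End hoeffding.

(** * Minimum distance estimation *)

Section l1_distance.
Context d (T : measurableType d) (R : realType) (mu : {measure set T -> \bar R}).
Implicit Types (f g h : T -> R) (A : set T).

Definition l1 f g : R := \int[mu]_x `|f x - g x|.

Lemma is_pdf_integrable f : is_pdf mu f -> mu.-integrable [set: T] (EFin \o f).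
Proof.
move=> [mf f0 f1]; apply/integrableP; split; first exact/measurable_EFinP.
rewrite (_ : \int[mu]_x _ = 1)%E ?ltry// -f1; apply: ae_eq_integral => //.
- by apply: measurableT_comp => //; exact/measurable_EFinP.
- exact/measurable_EFinP.
- by apply: filterS f0 => x f0 _ /=; rewrite ger0_norm.
Qed.

Lemma integrable_dist f g : mu.-integrable [set: T] (EFin \o f) ->
  mu.-integrable [set: T] (EFin \o g) ->
  mu.-integrable [set: T] (EFin \o (fun x => `|f x - g x|)).
Proof.
move=> If Ig; apply: (@integrable_norm _ _ _ mu setT (fun x => f x - g x)).
exact: (integrableB measurableT If Ig).
Qed.

Lemma l1_ge0 f g : 0 <= l1 f g.
Proof. exact: Rintegral_ge0. Qed.

Lemma l1C f g : l1 f g = l1 g f.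
Proof. by apply: eq_Rintegral => x _; rewrite distrC. Qed.

Lemma l1_triangle f g h : mu.-integrable [set: T] (EFin \o f) ->
  mu.-integrable [set: T] (EFin \o g) -> mu.-integrable [set: T] (EFin \o h) ->
  l1 f h <= l1 f g + l1 g h.
Proof.
move=> If Ig Ih; have Ifg := integrable_dist If Ig; have Igh := integrable_dist Ig Ih.
rewrite /l1 -RintegralD//; apply: le_Rintegral => //.
- exact: integrable_dist.
- exact: (integrableD measurableT Ifg Igh).
- by move=> x _; rewrite (le_trans _ (ler_normD _ _))// addrA subrK.
Qed.

Lemma Rintegral_setTC f A : measurable A -> mu.-integrable [set: T] (EFin \o f) ->
  \int[mu]_x f x = \int[mu]_(x in A) f x + \int[mu]_(x in ~` A) f x.
Proof.
move=> mA If; rewrite -Rintegral_setU ?setUv//; first exact: measurableC.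
by rewrite disj_set2E setICr.
Qed.

Lemma is_pdf_Rintegral f : is_pdf mu f -> \int[mu]_x f x = 1.
Proof. by move=> [_ _ f1]; rewrite /Rintegral f1. Qed.

Lemma pdf_diff_setC f g A : measurable A -> is_pdf mu f -> is_pdf mu g ->
  \int[mu]_(x in ~` A) (f x - g x) = - \int[mu]_(x in A) (f x - g x).
Proof.
move=> mA pf pg; apply/eqP; rewrite -addr_eq0 addrC -Rintegral_setTC//.
  by rewrite RintegralB ?is_pdf_Rintegral ?subrr//; exact: is_pdf_integrable.
by have := integrableB measurableT (is_pdf_integrable pf) (is_pdf_integrable pg).
Qed.

(** Two densities have opposite differences of mass on A and on its complement. Each is bounded by
    the part of the L1 distance located there, so twice the difference is at most the whole
    distance. *)
Lemma dist_pdf_le_half_l1 f g A : measurable A -> is_pdf mu f -> is_pdf mu g ->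
  `|\int[mu]_(x in A) (f x - g x)| <= l1 f g / 2.
Proof.
move=> mA pf pg; rewrite ler_pdivlMr// mulrDr mulr1.
have Id : mu.-integrable [set: T] (EFin \o (fun x => f x - g x)).
  exact: (integrableB measurableT (is_pdf_integrable pf) (is_pdf_integrable pg)).
rewrite -[X in _ + X]normrN -pdf_diff_setC// /l1 (@Rintegral_setTC _ A)//; last first.
  exact: integrable_norm.
have IS B : measurable B -> mu.-integrable B (EFin \o (fun x => f x - g x)).
  by move=> mB; exact: integrableS Id.
have mAC := measurableC mA.
by apply: lerD; apply: le_normr_Rintegral => //; exact: IS.
Qed.

(** On the set where f exceeds g the absolute value opens with a plus sign, off it with a minus
    sign; since both masses are 1, the two contributions are equal. *)
Lemma scheffe f g : is_pdf mu f -> is_pdf mu g ->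
  l1 f g = \int[mu]_(x in [set x | g x < f x]) (f x - g x) *+ 2.
Proof.
move=> pf pg; set A := [set x | _].
have mA : measurable A.
  have [mf _ _] := pf; have [mg _ _] := pg.
  have := measurable_fun_ltr mg mf measurableT (Y := [set true]).
  by rewrite setTI; exact.
have Id : mu.-integrable [set: T] (EFin \o (fun x => f x - g x)).
  exact: (integrableB measurableT (is_pdf_integrable pf) (is_pdf_integrable pg)).
rewrite /l1 (@Rintegral_setTC _ A)//; last exact: integrable_norm.
rewrite mulr2n; congr (_ + _).
  by apply: eq_Rintegral => x /set_mem/= gf; rewrite ger0_norm// subr_ge0 ltW.
rewrite -[RHS]opprK -pdf_diff_setC// -mulN1r -RintegralZl//; last 2 first.
- exact: measurableC.
- by apply: integrableS Id => //; exact: measurableC.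
apply: eq_Rintegral => x; rewrite inE => /= /negP; rewrite -leNgt => fg.
by rewrite ler0_norm ?subr_le0// mulN1r.
Qed.

End l1_distance.

Section minimum_distance.
Context d (T : measurableType d) (R : realType) (mu : {measure set T -> \bar R}).
Variables (F : finType) (f : F -> T -> R).
Hypothesis pdf_f : forall c, is_pdf mu (f c).

(** The Yatracos class of the candidates, indexed by ordered pairs; diagonal pairs contribute the
    empty set. *)
Definition yatracos_set (ab : F * F) : set T := [set x | f ab.2 x < f ab.1 x].

Lemma measurable_yatracos_set ab : measurable (yatracos_set ab).
Proof.
have [m1 _ _] := pdf_f ab.1; have [m2 _ _] := pdf_f ab.2.
have := measurable_fun_ltr m2 m1 measurableT (Y := [set true]).
by rewrite setTI; exact.
Qed.

Definition yatracos_error (e : F * F -> R) (c : F) : R :=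
  \big[Order.max/0]_ab `|\int[mu]_(x in yatracos_set ab) f c x - e ab|.

(** The error of [c] is at most D = l1(p, f_c) / 2 + eps, hence so is that of [c']. On the Scheffe
    set of (c', c) the two candidates then differ in mass by at most 2 D, so their L1 distance is at
    most 4 D, and the triangle inequality through f_c gives the constants 3 and 4. *)
Lemma minimum_distance_le (p : T -> R) (e : F * F -> R) (eps : R) (c c' : F) :
  is_pdf mu p -> 0 <= eps ->
  (forall ab, `|\int[mu]_(x in yatracos_set ab) p x - e ab| <= eps) ->
  yatracos_error e c' <= yatracos_error e c ->
  l1 mu p (f c') <= 3 * l1 mu p (f c) + 4 * eps.
Proof.
move=> pdf_p eps0 dev c'c.
have If a : mu.-integrable [set: T] (EFin \o f a) by exact: is_pdf_integrable.
have Ip : mu.-integrable [set: T] (EFin \o p) by exact: is_pdf_integrable.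
have IS ab (g : T -> R) : mu.-integrable [set: T] (EFin \o g) ->
    mu.-integrable (yatracos_set ab) (EFin \o g).
  by move=> Ig; apply: integrableS Ig => //; exact: measurable_yatracos_set.
pose D := l1 mu p (f c) / 2 + eps.
have cD : yatracos_error e c <= D.
  apply: bigmax_le => [|ab _].
    by rewrite addr_ge0// divr_ge0// l1_ge0.
  rewrite /D l1C.
  have := dist_pdf_le_half_l1 (measurable_yatracos_set ab) (pdf_f c) pdf_p.
  rewrite RintegralB; [|exact: measurable_yatracos_set|exact/IS/If|exact/IS/Ip].
  move=> h; rewrite (le_trans _ (lerD h (dev ab)))//.
  by rewrite (le_trans _ (ler_normD _ _))// addrA subrK.
have err_le a ab : yatracos_error e a <= D ->
    `|\int[mu]_(x in yatracos_set ab) f a x - e ab| <= D.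
  by apply: le_trans; rewrite /yatracos_error (bigD1 ab)//= le_max lexx.
have h : l1 mu (f c') (f c) <= 4 * D.
  rewrite (scheffe (pdf_f c') (pdf_f c)).
  have := err_le _ (c', c) (le_trans c'c cD); have := err_le _ (c', c) cD.
  rewrite RintegralB; [|exact: (measurable_yatracos_set (c', c))
                |exact: (IS (c', c))|exact: (IS (c', c))].
  rewrite !ler_norml mulr2n /yatracos_set/=; lra.
have := l1_triangle Ip (If c) (If c'); rewrite (l1C _ (f c)).
move: h; rewrite /D; lra.
Qed.

Context (n : nat) (c0 : F).

Definition yatracos_pattern (s : n.-tuple T) : {ffun 'I_n * (F * F) -> bool} :=
  indicator_pattern (fun z (s : n.-tuple T) => tnth s z.1)
    (fun z => yatracos_set z.2) s.

Definition pattern_frequency (t : {ffun 'I_n * (F * F) -> bool}) (ab : F * F) : R :=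
  (\sum_(i < n) (t (i, ab))%:R) / n%:R.

Definition minimum_distance (s : n.-tuple T) : F :=
  [arg min_(c < c0) yatracos_error (pattern_frequency (yatracos_pattern s)) c]%O.

(* The selection depends on the sample only through a finite-valued statistic. *)
Lemma measurable_minimum_distance (c : F) :
  measurable [set s | minimum_distance s = c].
Proof.
pose Q t := [arg min_(c < c0) yatracos_error (pattern_frequency t) c]%O == c.
rewrite (_ : [set s | _] = [set s | Q (yatracos_pattern s)]); last first.
  by apply/seteqP; split=> s; rewrite /Q /= -/(minimum_distance s) => /eqP.
apply: measurable_finite_data => t; apply: measurable_indicator_pattern => z.
  exact: measurable_tnth.
exact: measurable_yatracos_set.
Qed.

(** If no Yatracos set has an empirical deviation of eps or more, [minimum_distance_le] applies to
    the selected candidate. A union bound over the ordered pairs of candidates controls the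
    exceptional event. *)
Lemma minimum_distance_tail dO (Omega : measurableType dO) (P : probability Omega R)
    (X : 'I_n -> {RV P >-> T}) (p : T -> R) (eps t : R) (c : F) :
  (0 < n)%N -> is_pdf mu p -> mutually_independent X ->
  (forall i A, measurable A -> P (X i @^-1` A) = (\int[mu]_(x in A) (p x)%:E)%E) ->
  0 < eps -> 3 * l1 mu p (f c) + 4 * eps <= t ->
  (P [set omega | (t < l1 mu p (f (minimum_distance [tuple X i omega | i < n])))%R]
    <= (2 * #|F|%:R ^+ 2 * expR (- (n%:R * eps ^+ 2)))%:E)%E.
Proof.
move=> n0 pdf_p Xind XP eps0 tE.
pose q ab := \int[mu]_(x in yatracos_set ab) p x.
have Ip : mu.-integrable [set: T] (EFin \o p) by exact: is_pdf_integrable.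
have mY := measurable_yatracos_set.
have qE ab : (q ab)%:E = (\int[mu]_(x in yatracos_set ab) (p x)%:E)%E.
  rewrite /q /Rintegral fineK//; apply: integrable_fin_num => //.
  exact: integrableS Ip.
(* These masses are probabilities for the first observation, which exists because n > 0. *)
have q01 ab : 0 <= q ab <= 1.
  apply/andP; split; first by rewrite -lee_fin qE -(XP (Ordinal n0))//; exact: measure_ge0.
  by rewrite -lee_fin qE -(XP (Ordinal n0))// probability_le1//
    -[X in measurable X]setTI; exact: measurable_funP.
pose E ab := [set omega |
  n%:R * eps <= `|\sum_i (((X i omega \in yatracos_set ab) : bool)%:R - q ab)|].
have mE ab : measurable (E ab).
  exact: (@measurable_indicator_sum _ _ _ _ _ _ _ X _ _ (fun x => n%:R * eps <= `|x|)).
have PE ab : (P (E ab) <= (2 * expR (- (n%:R * eps ^+ 2)))%:E)%E.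
  apply: hoeffding_empirical => //; first exact: ltW.
  by move=> i; rewrite XP.
have mtuple : measurable_fun [set: Omega] (fun omega => [tuple X i omega | i < n]).
  apply/measurable_fun_tnthP => i.
  rewrite (_ : _ \o _ = X i)//.
  by apply/funext => omega /=; rewrite tnth_mktuple.
apply: (@le_trans _ _ (P (\big[setU/set0]_(ab <- enum {: F * F}) E ab))).
  apply: le_measure; rewrite ?inE.
  - pose Q a := t < l1 mu p (f a).
    apply: (@measurable_finite_data _ _ _ _ Q) => a.
    rewrite -[X in measurable X]setTI.
    by apply: (mtuple measurableT [set s | minimum_distance s = a]);
      exact: measurable_minimum_distance.
  - by apply: bigsetU_measurable.
  move=> omega /= tl; rewrite -bigcup_seq.
  apply/not_notP => nE; move: tl; apply/negP; rewrite -leNgt.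
  apply: le_trans tE; set s := mktuple _.
  apply: (@minimum_distance_le _ (pattern_frequency (yatracos_pattern s))) => //.
  - exact: ltW.
  - move=> ab; have /negP : ~ E ab omega.
      by move=> Eab; apply: nE; exists ab => //=; rewrite mem_enum.
    rewrite -ltNge => /ltW; rewrite sumrB sumr_const card_ord -[q ab *+ n]mulr_natl.
    rewrite /pattern_frequency distrC => h.
    have n0' : 0 < n%:R :> R by rewrite ltr0n.
    rewrite -(ler_pM2l n0') (le_trans _ h)// -[X in X * `|_|]gtr0_norm// -normrM.
    rewrite mulrBr mulrCA divff ?gt_eqF// mulr1.
    rewrite (eq_bigr (fun i => (X i omega \in yatracos_set ab)%:R)).
      by rewrite distrC.
    by move=> i _; rewrite ffunE/= tnth_mktuple.
  - by rewrite /minimum_distance; case: arg_minP => //= a _; exact.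
have Boole (r : seq (F * F)) : (P (\big[setU/set0]_(ab <- r) E ab) <=
    \sum_(ab <- r) P (E ab))%E.
  elim: r => [|ab r IH]; first by rewrite !big_nil measure0.
  rewrite !big_cons; apply: le_trans (measureU2 _ _ _) _ => //.
    exact: bigsetU_measurable.
  exact: leeD.
apply: le_trans (Boole _) _.
apply: le_trans (lee_sum _ _) _; first by move=> ab _; exact: PE.
rewrite sumEFin lee_fin big_enum/= sumr_const card_prod -[X in X <= _]mulr_natr natrM.
by rewrite le_eqVlt; apply/orP; left; apply/eqP; ring.
Qed.

End minimum_distance.

(** * Product densities *)

(** The measure in dimension d + 1 is the image of a product measure under [cons_pair], so the
    integral pulls back to the product, where Tonelli separates the variables. *)
Lemma ge0_integral_lebesgue_nd_cons (R : realType) (d : nat)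
    (u : measurableTypeR R -> \bar R) (v : Rd R d -> \bar R) :
  measurable_fun [set: measurableTypeR R] u -> measurable_fun [set: Rd R d] v ->
  (forall x, 0 <= u x)%E -> (forall x, 0 <= v x)%E ->
  (\int[lebesgue_measure_nd R d.+1]_x (u (tnth x ord0) * v [tuple of behead x]) =
   \int[lebesgue_measure]_x u x * \int[lebesgue_measure_nd R d]_x v x)%E.
Proof.
move=> mu mv u0 v0.
pose m1 := @lebesgue_measure R; pose m2 := lebesgue_measure_nd R d.
pose cp := @cons_pair _ (measurableTypeR R) d.
have mcp : measurable_fun setT cp by exact: measurable_cons_pair.
pose f (x : Rd R d.+1) := (u (tnth x ord0) * v [tuple of behead x])%E.
have mf : measurable_fun setT f.
  apply: emeasurable_funM; apply: measurableT_comp => //.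
    exact: measurable_tnth.
  exact: measurable_behead.
have f0 x : (0 <= f x)%E by exact: mule_ge0.
transitivity (\int[(m1 \x m2)%E]_z (f \o cp) z)%E.
  by rewrite -(@ge0_integral_pushforward _ _ _ _ _ cp mcp (m1 \x m2)%E setT f)//.
have fE z : (f \o cp) z = (u z.1 * v z.2)%E.
  by rewrite /f /cp /cons_pair /= tnth0; congr (_ * v _)%E; exact: val_inj.
under eq_integral do rewrite fE.
rewrite fubini_tonelli1//=; last 2 first.
- by apply: emeasurable_funM; apply: measurableT_comp.
- by move=> z; exact: mule_ge0.
rewrite /fubini_F /=.
under eq_integral do rewrite ge0_integralZl//.
rewrite ge0_integralZr//; exact: integral_ge0.
Qed.

Lemma ge0_integral_lebesgue_nd_prod (R : realType) (d : nat)
    (g : 'I_d -> measurableTypeR R -> R) :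
  (forall j, measurable_fun [set: measurableTypeR R] (g j)) ->
  (forall j x, 0 <= g j x) ->
  (\int[lebesgue_measure_nd R d]_x (\prod_(j < d) g j (tnth x j))%:E =
   \prod_(j < d) \int[lebesgue_measure]_x (g j x)%:E)%E.
Proof.
elim: d g => [|d IH] g mg g0.
  under eq_integral do rewrite big_ord0.
  by rewrite big_ord0 /= integral_cst//= mul1e; exact: diracT.
rewrite big_ord_recl -IH//.
rewrite -ge0_integral_lebesgue_nd_cons//.
- apply: eq_integral => x _; rewrite big_ord_recl EFinM; congr (_ * _%:E)%E.
  by apply: eq_bigr => j _; rewrite (tuple_eta x) tnthS -(tuple_eta x).
- exact/measurable_EFinP.
- apply/measurable_EFinP; apply: measurable_prod => j _.
  by apply: measurableT_comp => //; exact: measurable_tnth.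
- by move=> x; rewrite lee_fin.
- by move=> x; rewrite lee_fin; exact: prodr_ge0.
Qed.

Lemma measurable_prod_tnth (R : realType) (d : nat)
    (g : 'I_d -> measurableTypeR R -> R) :
  (forall j, measurable_fun [set: measurableTypeR R] (g j)) ->
  measurable_fun [set: Rd R d] (fun x => \prod_(j < d) g j (tnth x j)).
Proof.
move=> mg; apply: measurable_prod => j _.
by apply: measurableT_comp => //; exact: measurable_tnth.
Qed.

(** Induction on d with aA - cC = (a - c) A + c (A - C), where a, c are the first factors and A, C
    the remaining products. Both A and c integrate to 1, so each term keeps only its distance. *)
Lemma l1_prod_le (R : realType) (d : nat) (f g : 'I_d -> measurableTypeR R -> R) :
  (forall j, is_pdf (@lebesgue_measure R) (f j)) -> (forall j x, 0 <= f j x) ->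
  (forall j, is_pdf (@lebesgue_measure R) (g j)) -> (forall j x, 0 <= g j x) ->
  (\int[lebesgue_measure_nd R d]_x
     `|\prod_(j < d) f j (tnth x j) - \prod_(j < d) g j (tnth x j)|%:E <=
   \sum_(j < d) \int[@lebesgue_measure R]_x `|f j x - g j x|%:E)%E.
Proof.
elim: d f g => [|d IH] f g pf f0 pg g0.
  under eq_integral do rewrite !big_ord0 subrr normr0.
  by rewrite integral0 big_ord0.
have mf j : measurable_fun setT (f j) by have [] := pf j.
have mg j : measurable_fun setT (g j) by have [] := pg j.
pose F (x : Rd R d) := \prod_(j < d) f (lift ord0 j) (tnth x j).
pose G (x : Rd R d) := \prod_(j < d) g (lift ord0 j) (tnth x j).
have mF : measurable_fun setT F by exact: (measurable_prod_tnth (g := fun j => f (lift ord0 j))).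
have mG : measurable_fun setT G by exact: (measurable_prod_tnth (g := fun j => g (lift ord0 j))).
have F0 x : 0 <= F x by exact: prodr_ge0.
have IF : (\int[lebesgue_measure_nd R d]_x (F x)%:E = 1)%E.
  rewrite /F (ge0_integral_lebesgue_nd_prod (g := fun j => f (lift ord0 j)))// big1// => j _.
  by have [] := pf (lift ord0 j).
have Ig : (\int[@lebesgue_measure R]_x (g ord0 x)%:E = 1)%E by have [] := pg ord0.
pose H1 (x : Rd R d.+1) := (`|f ord0 (tnth x ord0) - g ord0 (tnth x ord0)|%:E *
  (F [tuple of behead x])%:E)%E.
pose H2 (x : Rd R d.+1) := ((g ord0 (tnth x ord0))%:E *
  `|F [tuple of behead x] - G [tuple of behead x]|%:E)%E.
have mfg : measurable_fun setT (fun x => `|f ord0 x - g ord0 x|).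
  by apply: measurableT_comp => //; exact: measurable_funB.
have mFG : measurable_fun setT (fun x => `|F x - G x|).
  by apply: measurableT_comp => //; exact: measurable_funB.
have mt : measurable_fun setT (fun x : Rd R d.+1 => tnth x ord0).
  exact: measurable_tnth.
have mb : measurable_fun setT (fun x : Rd R d.+1 => [tuple of behead x]).
  exact: measurable_behead.
have mH1 : measurable_fun setT H1.
  apply: emeasurable_funM; apply/measurable_EFinP.
    exact: (measurableT_comp mfg mt).
  exact: (measurableT_comp mF mb).
have mH2 : measurable_fun setT H2.
  apply: emeasurable_funM; apply/measurable_EFinP.
    exact: (measurableT_comp (mg ord0) mt).
  exact: (measurableT_comp mFG mb).
apply: (@le_trans _ _ (\int[lebesgue_measure_nd R d.+1]_x (H1 x + H2 x))%E).
  apply: ge0_le_integral => //.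
  - apply/measurable_EFinP; apply: measurableT_comp => //.
    by apply: measurable_funB; exact: measurable_prod_tnth.
  - exact: emeasurable_funD.
  move=> x _; rewrite /H1 /H2 -!EFinM -EFinD lee_fin !big_ord_recl.
  have Ex (h : 'I_d.+1 -> measurableTypeR R -> R) :
      \prod_(j < d) h (lift ord0 j) (tnth x (lift ord0 j)) =
      \prod_(j < d) h (lift ord0 j) (tnth [tuple of behead x] j).
    by apply: eq_bigr => j _; rewrite {1}(tuple_eta x) tnthS.
  rewrite !Ex -/(F _) -/(G _).
  set a := f _ _; set c := g _ _; set A := F _; set C := G _.
  have -> : a * A - c * C = (a - c) * A + c * (A - C) by ring.
  have A0 : 0 <= A by exact: F0.
  have c0 : 0 <= c by exact: g0.
  by rewrite (le_trans (ler_normD _ _))// !normrM (ger0_norm A0) (ger0_norm c0).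
rewrite ge0_integralD//; last 2 first.
- by move=> x _; rewrite mule_ge0// lee_fin.
- by move=> x _; rewrite mule_ge0// lee_fin.
rewrite /H1 /H2 (ge0_integral_lebesgue_nd_cons
  (u := fun x => `|f ord0 x - g ord0 x|%:E) (v := fun x => (F x)%:E)); first last.
- by move=> x; rewrite lee_fin F0.
- by move=> x; rewrite lee_fin.
- exact/measurable_EFinP.
- exact/measurable_EFinP.
rewrite (ge0_integral_lebesgue_nd_cons
  (u := fun x => (g ord0 x)%:E) (v := fun x => `|F x - G x|%:E)); first last.
- by move=> x; rewrite lee_fin.
- by move=> x; rewrite lee_fin.
- exact/measurable_EFinP.
- exact/measurable_EFinP.
rewrite IF Ig mule1 mul1e big_ord_recl; apply: leeD => //.
exact: IH.
Qed.

(** * Histograms of Lipschitz densities *)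

Section lipschitz_mean_deviation.
Context (R : realType).
Let mu := @lebesgue_measure R.
Variables (f : R -> R) (L a c : R).
Hypothesis ac : a < c.
Hypothesis fL : forall x y, `|f x - f y| <= L * `|x - y|.
Hypothesis If : mu.-integrable `[a, c] (EFin \o f).

Let len := c - a.
Let mid := (a + c) / 2.
Let avg := (\int[mu]_(x in `[a, c]) f x) / len.

Lemma Rintegral_sqr_dist_midpoint :
  \int[mu]_(x in `[a, c]) (x - mid) ^+ 2 = len ^+ 3 / 12.
Proof.
pose F (x : R) := (x - mid) ^+ 3 / 3.
have dF (x : R) : is_derive x 1 F ((x - mid) ^+ 2).
  by rewrite /F; apply: is_derive_eq; rewrite /GRing.scale/=; field.
have cF : continuous F.
  by move=> x; apply/differentiable_continuous/derivable1_diffP.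
rewrite /Rintegral (@continuous_FTC2 _ (fun x => (x - mid) ^+ 2) F a c ac).
- by rewrite /= /F /mid /len; field.
- by apply: continuous_subspaceT => x; apply/differentiable_continuous/derivable1_diffP.
- split=> [x _| |]; first by [].
    by apply: cvg_at_right_filter; exact: cF.
  by apply: cvg_at_left_filter; exact: cF.
- by move=> x _; rewrite derive1E derive_val.
Qed.

Let mu_len : fine (mu `[a, c]) = len.
Proof. by rewrite /mu lebesgue_measure_itv /= lte_fin ac. Qed.

Let Icst (k : R) : mu.-integrable `[a, c] (EFin \o cst k).
Proof.
apply: continuous_compact_integrable; first exact: segment_compact.
by apply: continuous_subspaceT => x; exact: cvg_cst.
Qed.

Let Isqr (k : R) : mu.-integrable `[a, c] (EFin \o (fun x => k * (x - mid) ^+ 2)).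
Proof.
apply: continuous_compact_integrable; first exact: segment_compact.
by apply: continuous_subspaceT => x; apply/differentiable_continuous/derivable1_diffP.
Qed.

Let Rintegral_avg : \int[mu]_(x in `[a, c]) f x = avg * len.
Proof. by rewrite /avg divfK// /len subr_eq0 gt_eqF. Qed.

Let mean_dev_le_parametric (s : R) : 0 < s ->
  \int[mu]_(x in `[a, c]) `|f x - avg| <= s * L ^+ 2 * len ^+ 3 / 24 + len / (2 * s).
Proof.
move=> s0.
have mI : measurable (`[a, c] : set (measurableTypeR R)) by exact: measurable_itv.
pose k := avg - f mid.
(* AM-GM gives |f - avg| <= s/2 (f - avg)^2 + 1/(2s); (f - avg)^2 is expanded
   around f(mid), and (f - f(mid))^2 <= L^2 (x - mid)^2. *)
pose C := s * k * f mid + s * k ^+ 2 / 2 + (2 * s)^-1.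
have Iabs : mu.-integrable `[a, c] (EFin \o (fun x => `|f x - avg|)).
  apply: (@integrable_norm _ _ _ mu _ (fun x => f x - avg)).
  by have := integrableB mI If (Icst avg).
have Ikf : mu.-integrable `[a, c] (EFin \o (fun x => - (s * k) * f x)).
  by have := integrableZl mI (- (s * k)) If.
have I2 : mu.-integrable `[a, c]
    (EFin \o (fun x => (s * L ^+ 2 / 2) * (x - mid) ^+ 2 + - (s * k) * f x)).
  by have := integrableD mI (Isqr (s * L ^+ 2 / 2)) Ikf.
have I3 : mu.-integrable `[a, c]
    (EFin \o (fun x => (s * L ^+ 2 / 2) * (x - mid) ^+ 2 + - (s * k) * f x + cst C x)).
  by have := integrableD mI I2 (Icst C).
apply: (@le_trans _ _ (\int[mu]_(x in `[a, c])
    ((s * L ^+ 2 / 2) * (x - mid) ^+ 2 + - (s * k) * f x + cst C x))).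
  apply: le_Rintegral => // x _; rewrite /cst /C.
  set u := f x - avg; have uE : f x = u + k + f mid by rewrite /u /k; ring.
  have h : (f x - f mid) ^+ 2 <= L ^+ 2 * (x - mid) ^+ 2.
    rewrite -(real_normK (num_real (f x - f mid))) -(real_normK (num_real (x - mid)))
      -exprMn.
    rewrite lerXn2r ?nnegrE// ?fL//; exact: le_trans (fL x mid).
  have h2 : 2 * s * `|u| <= s ^+ 2 * u ^+ 2 + 1.
    rewrite -(real_normK (num_real u)); have := sqr_ge0 (s * `|u| - 1); nra.
  rewrite -(ler_pM2l s0) -(ler_pM2l (ltr0n R 2)).
  have -> : 2%:R * (s * (s * L ^+ 2 / 2 * (x - mid) ^+ 2 + - (s * k) * f x +
     (s * k * f mid + s * k ^+ 2 / 2 + (2 * s)^-1))) =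
     s ^+ 2 * (L ^+ 2 * (x - mid) ^+ 2) - 2 * s ^+ 2 * k * (f x - f mid) + s ^+ 2 * k ^+ 2 + 1.
    by field; rewrite gt_eqF.
  have : s ^+ 2 * (f x - f mid) ^+ 2 <= s ^+ 2 * (L ^+ 2 * (x - mid) ^+ 2).
    by rewrite ler_wpM2l// sqr_ge0.
  have -> : s ^+ 2 * (f x - f mid) ^+ 2 = s ^+ 2 * u ^+ 2 + 2 * s ^+ 2 * k * u + s ^+ 2 * k ^+ 2.
    by rewrite uE; ring.
  have -> : f x - f mid = u + k by rewrite uE; ring.
  rewrite mulrA; lra.
have Isqr1 : mu.-integrable `[a, c] (EFin \o (fun x => (x - mid) ^+ 2)).
  by have := Isqr 1; rewrite (_ : (fun x => 1 * _) = (fun x => (x - mid) ^+ 2))//;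
    apply/funext => x; rewrite mul1r.
rewrite (RintegralD mI I2 (Icst C)) (RintegralD mI (Isqr _) Ikf).
rewrite (RintegralZl _ mI Isqr1) (RintegralZl _ mI If) Rintegral_sqr_dist_midpoint Rintegral_avg.
rewrite (_ : \int[mu]_(x in `[a, c]) cst C x = C * len); last first.
  by rewrite Rintegral_cst// mu_len.
(* The slack is what is gained by centering at the mean of f instead of at f(mid). *)
rewrite -subr_ge0 (_ : _ - _ = s * k ^+ 2 / 2 * len).
  have len0 : 0 <= len by rewrite subr_ge0 ltW.
  by rewrite mulr_ge0// divr_ge0// mulr_ge0 ?sqr_ge0// ltW.
by rewrite /C /k; field; rewrite gt_eqF.
Qed.

(** Optimizing the parametric bound over s plays the role of the Cauchy-Schwarz inequality. *)
Lemma lipschitz_mean_deviation :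
  \int[mu]_(x in `[a, c]) `|f x - avg| <= Num.sqrt 3 / 6 * L * len ^+ 2.
Proof.
have len0 : 0 < len by rewrite subr_gt0.
have L0 : 0 <= L.
  have := fL c a; rewrite -/len (gtr0_norm len0); have := normr_ge0 (f c - f a) => h1 h2.
  by rewrite -(pmulr_lge0 _ len0) (le_trans h1).
have [L0'|L0'] := eqVneq L 0.
  rewrite L0' mulr0 mul0r; apply/ler_addgt0Pl => e e0; rewrite addr0.
  (* For L = 0 the bound has no minimizer, but this s makes it equal to an arbitrary e > 0. *)
  have s0 : 0 < len / (2 * e) by rewrite divr_gt0// mulr_gt0.
  apply: le_trans (mean_dev_le_parametric s0) _.
  rewrite L0' expr0n/= mulr0 !mul0r add0r le_eqVlt; apply/orP; left; apply/eqP; field.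
  by rewrite !gt_eqF.
have Lp : 0 < L by rewrite lt0r L0' L0.
have q0 : 0 < Num.sqrt 3 :> R by rewrite sqrtr_gt0.
have q2 : Num.sqrt 3 ^+ 2 = 3 :> R by rewrite sqr_sqrtr.
(* The minimizer of s L^2 len^3 / 24 + len / (2 s). *)
have s0 : 0 < 2 * Num.sqrt 3 / (L * len) by rewrite divr_gt0 ?mulr_gt0.
apply: le_trans (mean_dev_le_parametric s0) _.
rewrite le_eqVlt; apply/orP; left; apply/eqP.
transitivity (Num.sqrt 3 / 12 * L * len ^+ 2 +
  L * len ^+ 2 * (Num.sqrt 3 ^+ 2)^-1 * Num.sqrt 3 / 4).
  by field; rewrite !gt_eqF.
by rewrite q2; field.
Qed.

End lipschitz_mean_deviation.

Section histogram.
Context (R : realType) (b : nat).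
Hypothesis b_gt0 : (0 < b)%N.
Let mu := @lebesgue_measure R.
Let b0 : 0 < b%:R :> R. Proof. by rewrite ltr0n. Qed.

(** Half-open bins tile [0, 1) without overlap, the bin of x being numbered by the integer part of b
    x. *)
Definition bin (t : 'I_b) : set (measurableTypeR R) :=
  `[t%:R / b%:R, t.+1%:R / b%:R[.

Lemma measurable_bin (t : 'I_b) : measurable (bin t).
Proof. exact: measurable_itv. Qed.

Lemma bin_truncn (t : 'I_b) (x : R) : bin t x -> Num.truncn (b%:R * x) = t.
Proof.
rewrite /bin/= in_itv/= ler_pdivrMr// ltr_pdivlMr// (mulrC x) => tx.
exact: truncn_def.
Qed.

Lemma in_bin (x : R) : `[0, 1[%classic x -> exists t : 'I_b, bin t x.
Proof.
rewrite /= in_itv/= => /andP[x0 x1].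
have bx0 : 0 <= b%:R * x by rewrite mulr_ge0// ltW.
have tb : (Num.truncn (b%:R * x) < b)%N.
  by rewrite truncn_lt_nat// gtr_pMr.
exists (Ordinal tb); rewrite /bin/= in_itv/= ler_pdivrMr// ltr_pdivlMr// (mulrC x).
exact: truncn_itv.
Qed.

Lemma bin_unit_itv (t : 'I_b) : bin t `<=` `[0, 1[.
Proof.
move=> x; rewrite /bin/= !in_itv/= => /andP[tx xt].
rewrite (le_trans _ tx) ?divr_ge0//= (lt_le_trans xt)//.
by rewrite ler_pdivrMr// mul1r ler_nat ltn_ord.
Qed.

Lemma lebesgue_measure_bin (t : 'I_b) : @lebesgue_measure R (bin t) = (b%:R^-1)%:E.
Proof.
rewrite lebesgue_measure_itv /= lte_fin ltr_pM2r ?invr_gt0// ltr_nat ltnSn.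
by rewrite -EFinD -mulrBl -natrB// subSnn mul1r.
Qed.

(** The parameter [v t] is the mass of a bin rather than its height, whence the factor b. *)
Definition histogram (v : 'I_b -> R) (x : measurableTypeR R) : R :=
  \sum_(t < b) b%:R * v t * \1_(bin t) x.

Lemma histogram_bin v (t : 'I_b) x : bin t x -> histogram v x = b%:R * v t.
Proof.
move=> tx; rewrite /histogram (bigD1 t)//= indicE mem_set// mulr1 big1 ?addr0//.
move=> u ut; rewrite indicE memNset ?mulr0// => ux.
by move/eqP: ut; apply; apply: val_inj; rewrite /= -(bin_truncn tx) -(bin_truncn ux).
Qed.

Lemma histogram_out v x : ~ (`[0, 1[%classic x) -> histogram v x = 0.
Proof.
move=> nx; rewrite /histogram big1// => t _; rewrite indicE memNset ?mulr0//.
by move=> /bin_unit_itv.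
Qed.

Lemma measurable_histogram v : measurable_fun [set: measurableTypeR R] (histogram v).
Proof.
apply: measurable_sum => t; apply: measurable_funM => //.
by apply: measurable_indic; exact: measurable_bin.
Qed.

Lemma histogram_ge0 v x : (forall t, 0 <= v t) -> 0 <= histogram v x.
Proof. by move=> v0; apply: sumr_ge0 => t _; rewrite !mulr_ge0. Qed.

Lemma ge0_integral_bins (g : measurableTypeR R -> R) :
  measurable_fun [set: measurableTypeR R] g -> (forall x, 0 <= g x) ->
  (\int[mu]_x (g x)%:E = \int[mu]_(x in ~` `[0%R, 1%R[) (g x)%:E +
    \sum_(t < b) \int[mu]_(x in bin t) (g x)%:E)%E.
Proof.
move=> mg g0.
have mG : measurable_fun [set: measurableTypeR R] (EFin \o g) by exact/measurable_EFinP.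
have mI : measurable (`[0%R, 1%R[ : set (measurableTypeR R)) by exact: measurable_itv.
rewrite -(setUv (`[0%R, 1%R[%classic : set (measurableTypeR R))) ge0_integral_setU//; last 4 first.
- exact: measurableC.
- by rewrite setUv.
- by move=> x _; rewrite lee_fin.
- by rewrite disj_set2E setICr.
rewrite addeC.
congr (_ + _)%E.
have -> : (`[0%R, 1%R[%classic : set (measurableTypeR R)) =
    \big[setU/set0]_(t <- enum 'I_b) bin t.
  rewrite -bigcup_seq; apply/seteqP; split=> x.
    by move=> /in_bin[t tx]; exists t => //=; rewrite mem_enum.
  by move=> [t _] /bin_unit_itv.
rewrite ge0_integral_bigsetU ?enum_uniq//.
- by rewrite big_enum.
- exact: measurable_bin.
- move=> t u _ _ [x [tx ux]]; apply: val_inj.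
  by rewrite /= -(bin_truncn tx) -(bin_truncn ux).
- exact: measurable_funTS.
- by move=> x _; rewrite lee_fin.
Qed.

Lemma integral_histogram v : (forall t, 0 <= v t) ->
  (\int[mu]_x (histogram v x)%:E = (\sum_(t < b) v t)%:E)%E.
Proof.
move=> v0; rewrite ge0_integral_bins//; last 2 first.
- exact: measurable_histogram.
- by move=> x; exact: histogram_ge0.
rewrite integral0_eq ?add0e; last by move=> x nx; rewrite histogram_out.
rewrite -sumEFin; apply: eq_bigr => t _.
rewrite (eq_integral (cst (b%:R * v t)%:E)); last first.
  by move=> x; rewrite inE => tx; rewrite (histogram_bin _ tx).
rewrite integral_cst; last exact: measurable_bin.
by rewrite [X in (_ * X)%E]lebesgue_measure_bin -EFinM mulrAC divff ?mul1r// gt_eqF.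
Qed.

Lemma is_pdf_histogram v : (forall t, 0 <= v t) -> \sum_(t < b) v t = 1 ->
  is_pdf mu (histogram v).
Proof.
move=> v0 v1; split; first exact: measurable_histogram.
- by apply: nearW => x; exact: histogram_ge0.
- by rewrite integral_histogram// v1.
Qed.

Lemma l1_histogram_le v v' :
  (\int[mu]_x `|histogram v x - histogram v' x|%:E <= (\sum_(t < b) `|v t - v' t|)%:E)%E.
Proof.
(* The right side is the integral of the histogram with masses |v - v'|, which dominates the
   difference pointwise. *)
rewrite -integral_histogram//; apply: ge0_le_integral => //.
- apply/measurable_EFinP; apply: measurableT_comp => //.
  by apply: measurable_funB; exact: measurable_histogram.
- by apply/measurable_EFinP; exact: measurable_histogram.
move=> x _; rewrite lee_fin /histogram -sumrB.
apply: le_trans (ler_norm_sum _ _ _) _; apply: ler_sum => t _.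
by rewrite -mulrBl -mulrBr !normrM (ger0_norm (ltW b0)) [X in _ * X]ger0_norm.
Qed.

Section lipschitz_bias.
Variables (f : measurableTypeR R -> R) (L : R).
Hypothesis pdf_f : is_pdf mu f.
Hypothesis f0 : forall x, 0 <= f x.
Hypothesis fL : forall x y : R, `|f x - f y| <= L * `|x - y|.
Hypothesis f_supp : (\int[mu]_(x in ~` `[0%R, 1%R[) (f x)%:E = 0)%E.

Definition bin_mass (t : 'I_b) : R := \int[mu]_(x in bin t) f x.

Lemma bin_mass_ge0 t : 0 <= bin_mass t.
Proof. by apply: Rintegral_ge0. Qed.

Let mf : measurable_fun [set: measurableTypeR R] f. Proof. by have [] := pdf_f. Qed.

Let If (A : set (measurableTypeR R)) : measurable A -> mu.-integrable A (EFin \o f).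
Proof. by move=> mA; apply: integrableS (is_pdf_integrable pdf_f). Qed.

Lemma sum_bin_mass : \sum_t bin_mass t = 1.
Proof.
apply: EFin_inj; rewrite -sumEFin.
have [_ _ <-] := pdf_f; rewrite ge0_integral_bins// f_supp add0e.
apply: eq_bigr => t _; rewrite /bin_mass /Rintegral fineK//.
apply: integrable_fin_num; [exact: measurable_bin|exact: (If (measurable_bin t))].
Qed.

(** On each bin the histogram equals the mean of f, so [lipschitz_mean_deviation] with length 1 / b
    applies to each of the b bins. *)
Lemma l1_histogram_bias :
  (\int[mu]_x `|f x - histogram bin_mass x|%:E <= (Num.sqrt 3 / 6 * L / b%:R)%:E)%E.
Proof.
have mh := measurable_histogram bin_mass.
have mfh : measurable_fun [set: measurableTypeR R] (fun x => `|f x - histogram bin_mass x|).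
  by apply: measurableT_comp => //; exact: measurable_funB.
rewrite ge0_integral_bins//.
rewrite (eq_integral (fun x => (f x)%:E)); last first.
  by move=> x; rewrite inE => nx; rewrite histogram_out// subr0 ger0_norm.
rewrite f_supp add0e.
apply: (@le_trans _ _ (\sum_(t < b) (Num.sqrt 3 / 6 * L * (b%:R^-1) ^+ 2)%:E)%E); last first.
  rewrite sumEFin lee_fin sumr_const card_ord -[X in X <= _]mulr_natr.
  by rewrite le_eqVlt; apply/orP; left; apply/eqP; field; rewrite gt_eqF.
apply: lee_sum => t _.
rewrite (eq_integral (fun x => `|f x - b%:R * bin_mass t|%:E)); last first.
  by move=> x; rewrite inE => tx; rewrite (histogram_bin _ tx).
have tt : t%:R / b%:R < t.+1%:R / b%:R :> R by rewrite ltr_pM2r ?invr_gt0// ltr_nat.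
have len : t.+1%:R / b%:R - t%:R / b%:R = b%:R^-1 :> R.
  by rewrite -mulrBl -natrB// subSnn mul1r.
have mc : measurable (`[t%:R / b%:R, t.+1%:R / b%:R] : set (measurableTypeR R)).
  exact: measurable_itv.
have mass : b%:R * bin_mass t =
    (\int[mu]_(x in `[t%:R / b%:R, t.+1%:R / b%:R]) f x) / (t.+1%:R / b%:R - t%:R / b%:R).
  rewrite len invrK mulrC /bin_mass /bin Rintegral_itv_bndo_bndc//.
  exact: (If (measurable_bin t)).
have := lipschitz_mean_deviation tt fL (If mc); rewrite -mass len.
(* The deviation bound is stated on closed intervals; the added endpoint is a null set. *)
rewrite -lee_fin; apply: le_trans; rewrite /bin integral_itv_bndo_bndc; last first.
  apply/measurable_EFinP; apply: measurableT_comp => //.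
  by apply: measurable_funB => //; exact: measurable_funTS.
rewrite /Rintegral fineK//.
apply: integrable_fin_num => //.
apply: (@integrable_norm _ _ _ mu _ (fun x => f x - b%:R * bin_mass t)).
have Icst : mu.-integrable `[t%:R / b%:R, t.+1%:R / b%:R] (EFin \o cst (b%:R * bin_mass t)).
  apply: continuous_compact_integrable; first exact: segment_compact.
  by apply: continuous_subspaceT => x; exact: cvg_cst.
exact: (integrableB mc (If mc) Icst).
Qed.

End lipschitz_bias.
End histogram.

(** * Mixtures of product histograms *)

Section multiview.
Context (R : realType) (d b k : nat).
Hypotheses (b_gt0 : (0 < b)%N) (k_gt0 : (0 < k)%N).
Let mu := lebesgue_measure_nd R d.

(** A single index type for the k weights and the kdb bin masses lets one grid discretize all
    parameters at once. *)
Definition view_index : finType := ('I_k + 'I_k * 'I_d * 'I_b)%type.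

Implicit Types theta : view_index -> R.

Definition view_weight theta (i : 'I_k) : R := theta (inl i).
Definition view_mass theta (i : 'I_k) (j : 'I_d) (t : 'I_b) : R := theta (inr (i, j, t)).

Definition view_valid theta : Prop :=
  [/\ forall z, 0 <= theta z, \sum_i view_weight theta i = 1 &
      forall i j, \sum_t view_mass theta i j t = 1].

Definition view_prod theta (i : 'I_k) (x : Rd R d) : R :=
  \prod_(j < d) histogram (view_mass theta i j) (tnth x j).

Definition multiview theta (x : Rd R d) : R :=
  \sum_i view_weight theta i * view_prod theta i x.

Lemma measurable_view_prod theta i : measurable_fun [set: Rd R d] (view_prod theta i).
Proof.
apply: (measurable_prod_tnth (g := fun j => histogram (view_mass theta i j))) => j.
exact: measurable_histogram.
Qed.

Lemma measurable_multiview theta : measurable_fun [set: Rd R d] (multiview theta).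
Proof.
apply: measurable_sum => i; apply: measurable_funM => //.
exact: measurable_view_prod.
Qed.

Lemma view_prod_ge0 theta i x : view_valid theta -> 0 <= view_prod theta i x.
Proof.
by move=> [t0 _ _]; apply: prodr_ge0 => j _; apply: histogram_ge0 => t; exact: t0.
Qed.

Lemma multiview_ge0 theta x : view_valid theta -> 0 <= multiview theta x.
Proof.
move=> vt; apply: sumr_ge0 => i _; rewrite mulr_ge0 ?view_prod_ge0//.
by have [t0 _ _] := vt; exact: t0.
Qed.

Lemma integral_view_prod theta i : view_valid theta ->
  (\int[mu]_x (view_prod theta i x)%:E = 1)%E.
Proof.
move=> [t0 _ t1].
rewrite /view_prod (ge0_integral_lebesgue_nd_prod (g := fun j => histogram (view_mass theta i j))).
- rewrite big1// => j _; rewrite integral_histogram//.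
    by rewrite t1.
  by move=> t; exact: t0.
- by move=> j; exact: measurable_histogram.
- by move=> j x; apply: histogram_ge0 => t; exact: t0.
Qed.

Lemma cube_pdf_multiview theta : view_valid theta -> cube_pdf (multiview theta).
Proof.
move=> vt; have [t0 t1 _] := vt; split.
  split; first exact: measurable_multiview.
    by apply: nearW => x; exact: multiview_ge0.
  rewrite /multiview; under eq_integral do rewrite -sumEFin.
  rewrite ge0_integral_sum//.
  - rewrite -[RHS]/(1%:E) -t1 -sumEFin; apply: eq_bigr => i _.
    under eq_integral do rewrite EFinM.
    rewrite ge0_integralZl_EFin//.
    + by rewrite integral_view_prod// mule1.
    + by move=> x _; rewrite lee_fin view_prod_ge0.
    + by apply/measurable_EFinP; exact: measurable_view_prod.
    + exact: t0.
  - move=> i; apply/measurable_EFinP; apply: measurable_funM => //.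
    exact: measurable_view_prod.
  - by move=> i x _; rewrite lee_fin mulr_ge0 ?view_prod_ge0//; exact: t0.
apply: nearW => x nx; rewrite /multiview big1// => i _.
have [j nj] : exists j, ~ (`[0%R, 1%R[%classic (tnth x j)).
  apply/existsNP => h; apply: nx => j; have := h j.
  by rewrite /= in_itv/= => /andP[-> /ltW ->].
by rewrite /view_prod (bigD1 j)//= histogram_out// mul0r mulr0.
Qed.

(** From wp - w'p' = w (p - p') + (w - w') p', with p' of integral 1. Keeping w as the factor of the
    first term lets the mass errors be averaged over the components instead of added up. *)
Lemma l1_multiview_le theta theta' : view_valid theta -> view_valid theta' ->
  (\int[mu]_x `|multiview theta x - multiview theta' x|%:E <=
   (\sum_i (view_weight theta i * \sum_j \sum_t
       `|view_mass theta i j t - view_mass theta' i j t| +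
     `|view_weight theta i - view_weight theta' i|))%:E)%E.
Proof.
move=> vt vt'; have [t0 _ t1] := vt; have [t0' _ t1'] := vt'.
pose D i x := `|view_prod theta i x - view_prod theta' i x|.
have D0 i x : 0 <= D i x by exact: normr_ge0.
have mD i : measurable_fun [set: Rd R d] (D i).
  apply: measurableT_comp => //.
  by apply: measurable_funB; exact: measurable_view_prod.
pose G i x : \bar R := ((view_weight theta i)%:E * (D i x)%:E +
  `|view_weight theta i - view_weight theta' i|%:E * (view_prod theta' i x)%:E)%E.
have mvp th i : measurable_fun [set: Rd R d] (fun x => (view_prod th i x)%:E).
  by apply/measurable_EFinP; exact: measurable_view_prod.
have mDE i : measurable_fun [set: Rd R d] (fun x => (D i x)%:E) by exact/measurable_EFinP.
have mG i : measurable_fun [set: Rd R d] (G i).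
  by apply: emeasurable_funD; apply: measurable_funeM.
have G0 i x : (0 <= G i x)%E.
  by apply: adde_ge0; apply: mule_ge0; rewrite lee_fin ?view_prod_ge0//; exact: t0.
apply: (@le_trans _ _ (\int[mu]_x \sum_i G i x)%E).
  apply: ge0_le_integral => //.
  - apply/measurable_EFinP; apply: measurableT_comp => //.
    by apply: measurable_funB; exact: measurable_multiview.
  - exact: emeasurable_sum.
  move=> x _; rewrite /G; under eq_bigr do rewrite -!EFinM -EFinD.
  rewrite sumEFin lee_fin /multiview -sumrB.
  apply: le_trans (ler_norm_sum _ _ _) _; apply: ler_sum => i _.
  rewrite /D; set w := view_weight theta i; set w' := view_weight theta' i.
  set p := view_prod theta i x; set p' := view_prod theta' i x.
  have -> : w * p - w' * p' = w * (p - p') + (w - w') * p' by ring.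
  have w0 : 0 <= w by exact: t0.
  have p0 : 0 <= p' by exact: view_prod_ge0.
  by rewrite (le_trans (ler_normD _ _))// !normrM (ger0_norm w0) (ger0_norm p0).
rewrite ge0_integral_sum// -sumEFin; apply: lee_sum => i _.
rewrite ge0_integralD//; first last.
- exact: measurable_funeM.
- by move=> x _; apply: mule_ge0; rewrite lee_fin ?view_prod_ge0.
- exact: measurable_funeM.
- by move=> x _; apply: mule_ge0; rewrite lee_fin//; exact: t0.
rewrite ge0_integralZl_EFin//; [|by move=> x _; rewrite lee_fin|exact: t0].
rewrite ge0_integralZl_EFin//; last by move=> x _; rewrite lee_fin view_prod_ge0.
rewrite integral_view_prod// mule1 EFinD EFinM; apply: leeD => //.
apply: lee_wpmul2l; first by rewrite lee_fin; exact: t0.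
apply: le_trans (l1_prod_le (f := fun j => histogram (view_mass theta i j))
    (g := fun j => histogram (view_mass theta' i j)) _ _ _ _) _.
- by move=> j; apply: is_pdf_histogram => // t; exact: t0.
- by move=> j x; apply: histogram_ge0 => t; exact: t0.
- by move=> j; apply: is_pdf_histogram => // t; exact: t0'.
- by move=> j x; apply: histogram_ge0 => t; exact: t0'.
rewrite -sumEFin; apply: lee_sum => j _; exact: l1_histogram_le.
Qed.

Section grid.
Variable N : nat.

(* The minimum with N puts the value 1 in the last cell. *)
Definition grid_cell theta : {ffun view_index -> 'I_N.+1} :=
  [ffun z => inord (minn (Num.truncn (N.+1%:R * theta z)) N)].

Lemma view_le1 theta z : view_valid theta -> theta z <= 1.
Proof.
move=> [t0 t1 tm]; case: z => [i|[[i j] t]].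
  by rewrite -t1 (bigD1 i)//= lerDl sumr_ge0// => l _; exact: t0.
by rewrite -(tm i j) (bigD1 t)//= lerDl sumr_ge0// => l _; exact: t0.
Qed.

Lemma grid_cell_itv theta z : view_valid theta ->
  (grid_cell theta z)%:R <= N.+1%:R * theta z <= (grid_cell theta z).+1%:R.
Proof.
move=> vt; have [t0 _ _] := vt; have tz1 := view_le1 z vt.
have Nt0 : 0 <= N.+1%:R * theta z by rewrite mulr_ge0.
rewrite ffunE inordK ?ltnS ?geq_minr//; have /andP[h1 /ltW h2] := truncn_itv Nt0.
have [tN|/ltnW Nt] := leqP (Num.truncn (N.+1%:R * theta z)) N.
  by rewrite h1 h2.
rewrite (le_trans _ h1) ?ler_nat//=; by rewrite ler_piMr.
Qed.

Lemma grid_cell_dist theta theta' z : view_valid theta -> view_valid theta' ->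
  grid_cell theta = grid_cell theta' -> `|theta z - theta' z| <= N.+1%:R^-1.
Proof.
move=> vt vt' e; have := grid_cell_itv z vt; have := grid_cell_itv z vt'.
rewrite -e -[(grid_cell theta z).+1%:R]natr1; set c := _%:R => /andP[h1 h2] /andP[h3 h4].
have N0 : 0 < N.+1%:R :> R by rewrite ltr0n.
rewrite -(ler_pM2l N0) divff ?gt_eqF// -[X in X * _](gtr0_norm N0) -normrM mulrBr.
by rewrite ler_norml; lra.
Qed.

Lemma view_valid_exists : exists theta, view_valid theta.
Proof.
exists (fun z : 'I_k + 'I_k * 'I_d * 'I_b => match z with
  | inl i => ((i : nat) == 0)%:R
  | inr (_, _, t) => ((t : nat) == 0)%:R end).
split=> [[i|[[i j] t]]//| |i j].
  by rewrite (bigD1 (Ordinal k_gt0))//= big1 ?addr0// => i;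
    rewrite -val_eqE/= /view_weight => /negPf ->.
by rewrite (bigD1 (Ordinal b_gt0))//= big1 ?addr0// => t;
  rewrite -val_eqE/= /view_mass => /negPf ->.
Qed.

(** A corner or center of a cell would in general violate the constraints that weights and masses
    sum to 1, so a valid point of the cell is chosen instead; cells without one receive a fixed
    valid parameter. In the error, db comes from the masses, averaged with weights of sum 1, and k
    from the weights. *)
Lemma grid_cover : exists rep : {ffun view_index -> 'I_N.+1} -> view_index -> R,
  (forall c, view_valid (rep c)) /\
  forall theta, view_valid theta ->
    (\int[mu]_x `|multiview theta x - multiview (rep (grid_cell theta)) x|%:E <=
      ((d * b + k)%:R / N.+1%:R)%:E)%E.
Proof.
have [theta0 vt0] := view_valid_exists.
pose Q c theta := view_valid theta /\ grid_cell theta = c.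
have /choice[rep repP] : forall c, exists theta, view_valid theta /\
    ((exists theta', Q c theta') -> grid_cell theta = c).
  move=> c; have [[theta [vt tc]]|nQ] := pselect (exists theta', Q c theta').
    by exists theta.
  by exists theta0; split.
exists rep; split=> [c|theta vt]; first by have [] := repP c.
have [vr rE] := repP (grid_cell theta).
have {}rE : grid_cell (rep (grid_cell theta)) = grid_cell theta by apply: rE; exists theta.
apply: le_trans (l1_multiview_le vt vr) _; rewrite lee_fin.
have dz z := grid_cell_dist z vt vr (esym rE).
have [t0 t1 _] := vt.
rewrite big_split/= natrD mulrDl; apply: lerD.
  apply: (@le_trans _ _ (\sum_i view_weight theta i * ((d * b)%:R / N.+1%:R))).
    apply: ler_sum => i _; apply: ler_wpM2l; first exact: t0.
    apply: (@le_trans _ _ (\sum_(j < d) \sum_(t < b) N.+1%:R^-1)).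
      by apply: ler_sum => j _; apply: ler_sum => t _; exact: dz.
    by rewrite !sumr_const !card_ord -mulrnA mulnC mulr_natl.
  by rewrite -mulr_suml t1 mul1r.
apply: (@le_trans _ _ (\sum_(i < k) N.+1%:R^-1)).
  by apply: ler_sum => i _; exact: dz.
by rewrite sumr_const card_ord mulr_natl.
Qed.

End grid.
End multiview.

(** * Truncation of the spectrum *)

(** A negative value at x forces f < 0 on [x, x + r], which has positive measure. Dividing by L + 1
    in [r] covers L = 0 and keeps the inequality strict. *)
Lemma lipschitz_ae_ge0 (R : realType) (f : R -> R) (L : R) :
  (forall x y, `|f x - f y| <= L * `|x - y|) ->
  {ae @lebesgue_measure R, forall x, 0 <= f x} -> forall x, 0 <= f x.
Proof.
move=> fL [N [mN N0 subN]] x; rewrite leNgt; apply/negP => fx0.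
have L0 : 0 <= L.
  have := fL (x + 1) x; rewrite [x + 1]addrC addrK normr1 mulr1; exact: le_trans.
pose r := - f x / (L + 1).
have r0 : 0 < r by rewrite divr_gt0 ?oppr_gt0// ltr_wpDl.
have sub : (`[x, (x + r)]%classic : set (measurableTypeR R)) `<=` N.
  move=> y; rewrite /= in_itv/= => /andP[xy yr]; apply: subN => /=; apply/negP.
  rewrite -ltNge.
  have := fL y x; rewrite (ger0_norm (_ : 0 <= y - x)) ?subr_ge0// => h.
  have h2 : L * (y - x) <= L * r by rewrite ler_wpM2l// lerBlDl.
  have h3 : (L + 1) * r = - f x by rewrite /r mulrC divfK// gt_eqF// ltr_wpDl.
  have := le_trans (ler_norm _) (le_trans h h2); lra.
have mI : measurable (`[x, (x + r)]%classic : set (measurableTypeR R)) by exact: measurable_itv.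
have := le_measure (@lebesgue_measure R) (mem_set mI) (mem_set mN) sub.
rewrite [X in (_ <= X)%E -> _]N0 [X in (X <= _)%E -> _]lebesgue_measure_itv /=
  lte_fin ltrDl r0 -EFinD lee_fin.
by rewrite addrC addKr leNgt r0.
Qed.

Section spectrum.
Context (R : realType) (d b k : nat).
Hypotheses (b_gt0 : (0 < b)%N) (k_gt0 : (0 < k)%N).
Let leb := @lebesgue_measure R.
Let mu := lebesgue_measure_nd R d.
Variables (p : Rd R d -> R) (w L : nat -> R) (q : nat -> 'I_d -> measurableTypeR R -> R).
Hypothesis p_cube : cube_pdf p.
Hypothesis w0 : forall i, 0 <= w i.
Hypothesis w1 : (\sum_(0 <= i <oo) (w i)%:E = 1)%E.
Hypothesis w00 : 0 < w 0%N.
Hypothesis pdf_q : forall i j, is_pdf leb (q i j).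
Hypothesis qL : forall i j x y, `|q i j x - q i j y| <= L i * `|x - y|.
Hypothesis pE : {ae mu, forall x, (p x)%:E =
  (\sum_(0 <= i <oo) (w i * \prod_(j < d) q i j (tnth x j))%:E)%E}.

Let q0 i j x : 0 <= q i j x.
Proof. by apply: (lipschitz_ae_ge0 (@qL i j)); have [] := pdf_q i j. Qed.

Let mq i j : measurable_fun [set: measurableTypeR R] (q i j).
Proof. by have [] := pdf_q i j. Qed.

Let comp i (x : Rd R d) := \prod_(j < d) q i j (tnth x j).

Let comp0 i x : 0 <= comp i x. Proof. exact: prodr_ge0. Qed.

Let mcomp i : measurable_fun [set: Rd R d] (comp i).
Proof. exact: (measurable_prod_tnth (g := q i)). Qed.

Let integral_comp i : (\int[mu]_x (comp i x)%:E = 1)%E.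
Proof.
rewrite (ge0_integral_lebesgue_nd_prod (g := q i))// big1// => j _.
by have [] := pdf_q i j.
Qed.

Let term_le i x : ((w i * comp i x)%:E <= \sum_(0 <= i <oo) (w i * comp i x)%:E)%E.
Proof.
rewrite (@nneseries_split _ _ 0 i.+1)//=; last first.
  by move=> l _; rewrite lee_fin mulr_ge0.
rewrite add0n big_nat_recr//=.
apply: lee_paddr; first by apply: nneseries_ge0 => l _ _; rewrite lee_fin mulr_ge0.
by apply: lee_paddl => //; apply: sume_ge0 => l _; rewrite lee_fin mulr_ge0.
Qed.

(** A component of positive weight is dominated by a multiple of p, so it vanishes a.e. off the
    cube. Restricting its j-th factor to the complement of [0, 1] thus gives a product of integral
    0, while the other factors integrate to 1. *)
Lemma spectrum_component_support i j : 0 < w i ->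
  (\int[leb]_(x in ~` `[0%R, 1%R[) (q i j x)%:E = 0)%E.
Proof.
move=> wi.
pose A : set (measurableTypeR R) := ~` `[0, 1]%classic.
have mA : measurable A by apply: measurableC; exact: measurable_itv.
pose g l := if l == j then fun x => q i l x * \1_A x else q i l.
have mg l : measurable_fun [set: measurableTypeR R] (g l).
  rewrite /g; case: ifP => // _; apply: measurable_funM.
    exact: mq.
  exact: measurable_indic.
have g0 l x : 0 <= g l x by rewrite /g; case: ifP => // _; rewrite mulr_ge0.
have mG : measurable_fun [set: Rd R d] (fun x => \prod_(l < d) g l (tnth x l)).
  exact: (measurable_prod_tnth (g := g)).
have G0 : (\int[mu]_x (\prod_(l < d) g l (tnth x l))%:E = 0)%E.
  rewrite (ge0_ae_eq_integral (g := cst 0%E))//.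
  - by rewrite integral_cst// mul0e.
  - exact/measurable_EFinP.
  - by move=> x _; rewrite lee_fin prodr_ge0.
  apply: filterS2 pE p_cube.2 => x px cx _ /=; congr EFin.
  have [Ax|nAx] := pselect (A (tnth x j)); last first.
    by rewrite (bigD1 j)//= {1}/g eqxx indicE memNset// mulr0 mul0r.
  have : p x = 0 by apply: cx => cube; apply: Ax; rewrite /= in_itv/=; exact: cube.
  move=> px0; have := term_le i x; rewrite -px px0 lee_fin pmulr_rle0//.
  move=> c0; have {c0} : comp i x = 0 by apply/eqP; rewrite eq_le c0 comp0.
  rewrite /comp => /eqP; rewrite prodf_seq_eq0 => /hasP[l _ /= ql].
  apply/eqP; rewrite prodf_seq_eq0; apply/hasP; exists l; rewrite ?mem_index_enum//=.
  by rewrite /g; case: ifP => // _; rewrite (eqP ql) mul0r.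
move: G0; rewrite ge0_integral_lebesgue_nd_prod// (bigD1 j)//= big1; last first.
  by move=> l lj; rewrite /g (negPf lj); have [] := pdf_q i l.
rewrite mule1 /g eqxx => G0.
(* The bins cover only [0, 1), so the null point 1 has to be added. *)
have -> : (~` `[0%R, 1%R[%classic : set (measurableTypeR R)) = A `|` [set 1%R].
  apply/seteqP; split=> x /=; rewrite /A/= !in_itv/=.
    move=> h; have [->|x1] := eqVneq x 1; first by right.
    by left; move=> /andP[x0 x1']; apply: h; rewrite x0/= lt_neqAle x1 x1'.
  move=> [h /andP[x0 x1]|->]; first by apply: h; rewrite x0 ltW.
  by rewrite ltxx andbF.
rewrite ge0_integral_setU//.
- rewrite integral_set1 adde0 -[RHS]G0 integral_mkcond; apply: eq_integral => x _.
  rewrite patchE indicE; case: (x \in A); by rewrite ?mulr1 ?mulr0.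
- by apply/measurable_EFinP; exact: measurable_funTS.
- by move=> x _; rewrite lee_fin.
- by apply/disj_setPS => x [/= Ax x1]; apply: Ax; rewrite x1/= in_itv/= ler01 lexx.
Qed.

(** The witness divides the first k weights by their sum [W] and gives the histograms the bin masses
    of the components. The tail is paid twice: once for the dropped terms, once for the mass 1 - W
    that the division restores. *)
Lemma spectrum_bias : exists2 theta : view_index d b k -> R, view_valid theta &
  (\int[mu]_x `|p x - multiview theta x|%:E <=
    2%:E * \sum_(k <= i <oo) (w i)%:E +
    (Num.sqrt 3 / 6 * d%:R / b%:R * \sum_(i < k) w i * L i)%:E)%E.
Proof.
pose W := \sum_(i < k) w i.
have W0 : 0 < W.
  by rewrite /W (bigD1 (Ordinal k_gt0))//= ltr_pwDl// sumr_ge0.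
have tailE : (\sum_(k <= i <oo) (w i)%:E = (1 - W)%:E)%E.
  have := @nneseries_split R (fun i => (w i)%:E) 0 k (fun i _ => w0 i).
  rewrite w1 add0n big_mkord sumEFin -/W => e.
  by rewrite EFinB [X in (X - _)%E]e addeAC subee// add0e.
have W1 : W <= 1.
  by rewrite -subr_ge0 -lee_fin -tailE; apply: nneseries_ge0 => i _ _; rewrite lee_fin.
(* A component of weight zero may live off the cube, where its bin masses need not sum to 1; it is
   replaced by a point mass on the first bin, at no cost. *)
pose mass i j (t : 'I_b) := if 0 < w i then bin_mass (q i j) t else ((t : nat) == 0)%:R.
pose theta : view_index d b k -> R := fun z : 'I_k + 'I_k * 'I_d * 'I_b => match z with
  | inl i => w i / W
  | inr (i, j, t) => mass i j t end.
have vt : view_valid theta.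
  split=> [[i|[[i j] t]]/=| |i j].
  - by rewrite divr_ge0// ltW.
  - by rewrite /mass; case: ifP => // _; exact: bin_mass_ge0.
  - by rewrite /view_weight/= -mulr_suml divff// gt_eqF.
  rewrite /view_mass/= /mass; have [wi|/negPf wi] := boolP (0 < w i).
    by apply: sum_bin_mass => //; exact: spectrum_component_support.
  by rewrite (bigD1 (Ordinal b_gt0))//= big1 ?addr0// => t; rewrite -val_eqE/= => /negPf ->.
exists theta => //.
pose H i x := view_prod theta i x.
have mH i : measurable_fun [set: Rd R d] (H i) by exact: measurable_view_prod.
have H0 i x : 0 <= H i x by exact: view_prod_ge0.
pose D (i : 'I_k) x := `|w i * comp i x - w i / W * H i x|.
have D0 i x : 0 <= D i x by exact: normr_ge0.
have mD i : measurable_fun [set: Rd R d] (D i).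
  by apply: measurableT_comp => //; apply: measurable_funB; apply: measurable_funM.
have mDE i : measurable_fun [set: Rd R d] (EFin \o D i) by exact/measurable_EFinP.
(* The tail series, padded with zeros so as to start at 0, can be integrated term by term. *)
pose fn n x : \bar R := if (k <= n)%N then (w n * comp n x)%:E else 0%E.
have fn0 n x : (0 <= fn n x)%E by rewrite /fn; case: ifP => // _; rewrite lee_fin mulr_ge0.
have mfn n : measurable_fun [set: Rd R d] (fn n).
  rewrite /fn; case: leqP => _; last exact: measurable_cst.
  by apply/measurable_EFinP; apply: measurable_funM.
have fnE x : (\sum_(k <= i <oo) (w i * comp i x)%:E = \sum_(n <oo) fn n x)%E.
  by rewrite eseries_cond eseries_mkcond; apply: eq_eseriesr => n _; rewrite /fn/=.
pose G x := (\sum_i (D i x)%:E + \sum_(n <oo) fn n x)%E.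
have mtail : measurable_fun [set: Rd R d] (fun x => \sum_(n <oo) fn n x)%E.
  by apply: ge0_emeasurable_sum => n x *.
apply: (@le_trans _ _ (\int[mu]_x G x)%E).
  apply: ae_ge0_le_integral => //.
  - apply/measurable_EFinP; apply: measurableT_comp => //; apply: measurable_funB.
      by have [[]] := p_cube.
    exact: measurable_multiview.
  - by move=> x _; apply: adde_ge0; [apply: sume_ge0 => i _; rewrite lee_fin|apply: nneseries_ge0].
  - apply: emeasurable_funD => //; apply: emeasurable_sum => i; exact: mDE.
  apply: filterS pE => x px _.
  have px' : (p x)%:E = (\sum_(0 <= i <oo) (w i * comp i x)%:E)%E by exact: px.
  rewrite (@nneseries_split R _ 0 k) in px'; last by move=> i _; rewrite lee_fin mulr_ge0.
  move: px'; rewrite add0n big_mkord sumEFin fnE /G.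
  have := @nneseries_ge0 R (fn ^~ x) xpredT 0 (fun n _ _ => fn0 n x).
  (* The tail at x is finite because p(x) is a real number. *)
  case: (\sum_(n <oo) fn n x)%E => [r| |]//= r0 [->].
  rewrite sumEFin -EFinD lee_fin /multiview addrAC -sumrB.
  apply: le_trans (ler_normD _ _) _; rewrite (ger0_norm (_ : 0 <= r))// lerD2r.
  exact: ler_norm_sum.
rewrite ge0_integralD//; first last.
- by move=> x _; apply: nneseries_ge0.
- by apply: emeasurable_sum => i; exact: mDE.
- by move=> x _; apply: sume_ge0 => i _; rewrite lee_fin.
rewrite integral_nneseries// ge0_integral_sum//; last by move=> i x _; rewrite lee_fin.
have -> : (\sum_(n <oo) \int[mu]_x fn n x = (1 - W)%:E)%E.
  rewrite -tailE [RHS]eseries_cond [RHS]eseries_mkcond; apply: eq_eseriesr => n _.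
  rewrite /fn/=; case: leqP => _; last by rewrite integral0.
  under eq_integral do rewrite EFinM.
  rewrite ge0_integralZl_EFin//; last 2 first.
  - by move=> x _; rewrite lee_fin.
  - exact/measurable_EFinP.
  by rewrite integral_comp mule1.
pose B (i : 'I_k) := w i * (Num.sqrt 3 / 6 * d%:R / b%:R * L i) + (w i / W - w i).
apply: (@le_trans _ _ ((\sum_i B i)%:E + (1 - W)%:E)%E); last first.
  rewrite tailE -EFinM -!EFinD lee_fin /B big_split/= sumrB -mulr_suml divff ?gt_eqF//.
  rewrite -/W (eq_bigr (fun i : 'I_k => Num.sqrt 3 / 6 * d%:R / b%:R * (w i * L i))).
    by rewrite -mulr_sumr; lra.
  by move=> i _; rewrite mulrCA.
apply: leeD => //; rewrite -sumEFin; apply: lee_sum => i _.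
have wW : 0 <= w i / W - w i.
  by rewrite subr_ge0 ler_pdivlMr// ler_piMr.
have mCH : measurable_fun [set: Rd R d] (fun x => `|comp i x - H i x|).
  by apply: measurableT_comp => //; exact: measurable_funB.
have mCHE : measurable_fun [set: Rd R d] (fun x => `|comp i x - H i x|%:E) by exact/measurable_EFinP.
have mHE : measurable_fun [set: Rd R d] (fun x => (H i x)%:E) by exact/measurable_EFinP.
apply: (@le_trans _ _ (\int[mu]_x ((w i)%:E * `|comp i x - H i x|%:E +
    (w i / W - w i)%:E * (H i x)%:E))%E).
  apply: ge0_le_integral => //.
  - by move=> x _; rewrite lee_fin.
  - exact: mDE.
  - by apply: emeasurable_funD; apply: measurable_funeM.
  move=> x _; rewrite -!EFinM -EFinD lee_fin /D.
  have -> : w i * comp i x - w i / W * H i x =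
    w i * (comp i x - H i x) - (w i / W - w i) * H i x by ring.
  by rewrite (le_trans (ler_normB _ _))// !normrM
    (ger0_norm (w0 i)) (ger0_norm wW) (ger0_norm (H0 i x)).
rewrite ge0_integralD//; first last.
- exact: measurable_funeM.
- by move=> x _; apply: mule_ge0; rewrite lee_fin.
- exact: measurable_funeM.
- by move=> x _; apply: mule_ge0; rewrite lee_fin.
rewrite ge0_integralZl_EFin//.
rewrite ge0_integralZl_EFin//; last by move=> x _; rewrite lee_fin.
rewrite integral_view_prod// mule1 /B [leRHS]EFinD; apply: leeD => //.
have [wi|wi] := ltP 0 (w i); last first.
  by have -> : w i = 0 by [apply/eqP; rewrite eq_le wi w0]; rewrite mul0e mul0r.
rewrite EFinM; apply: lee_wpmul2l; first by rewrite lee_fin.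
have [_ _ tm] := vt.
have th0 j t : 0 <= view_mass theta i j t by have [t0 _ _] := vt; exact: t0.
apply: le_trans (l1_prod_le (f := q i) (g := fun j => histogram (view_mass theta i j)) _ _ _ _) _ => //.
- by move=> j; apply: is_pdf_histogram.
- by move=> j x; exact: histogram_ge0.
apply: (@le_trans _ _ (\sum_(j < d) (Num.sqrt 3 / 6 * L i / b%:R)%:E)%E).
  apply: lee_sum => j _.
  have -> : view_mass theta i j = bin_mass (q i j).
    by apply/funext => t; rewrite /view_mass /= /mass wi.
  apply: l1_histogram_bias => //; exact: spectrum_component_support.
rewrite sumEFin lee_fin sumr_const card_ord -[X in X <= _]mulr_natr.
by rewrite le_eqVlt; apply/orP; left; apply/eqP; ring.
Qed.
End spectrum.

(** * Choice of the parameters *)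

(** Equivalently e <= 4, the square of exp(1/2) <= 2, which is exp(-1/2) >= 1 - 1/2. *)
Lemma ln4_ge1 (R : realType) : 1 <= ln (4 : R).
Proof.
rewrite -ler_expR lnK ?posrE//.
have h : expR (2^-1) <= 2 :> R.
  have e0 := expR_gt0 (2^-1 : R).
  have := expR_ge1Dx (- 2^-1 : R); rewrite expRN -(ler_pM2r e0) mulVf ?gt_eqF//; lra.
have -> : expR 1 = expR (2^-1) ^+ 2 :> R by rewrite -expRM_natl mulfV.
have := expR_gt0 (2^-1 : R); nra.
Qed.

Section sample_size.
Context (R : realType) (d b k n : nat) (delta : R).
Hypotheses (d_gt0 : (0 < d)%N) (b_gt0 : (0 < b)%N) (k_gt0 : (0 < k)%N) (n_gt0 : (0 < n)%N).
Hypotheses (delta_gt0 : 0 < delta) (delta_le1 : delta <= 1).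

Let B : R := b%:R * d%:R * k%:R.
Let size_log : R := ln (4 * B * n%:R).
(** With X = 4Bn, this makes exp(- n eps^2) equal to X^(-4B) delta / 3, where X^(4B) bounds the
    squared number of candidates. *)
Let eps : R := Num.sqrt ((4 * B * size_log + ln (3 / delta)) / n%:R).
Let T : R := Num.sqrt (2 * B * size_log / n%:R).
Let S : R := Num.sqrt (ln (3 / delta) / (2 * n%:R)).

Let B1 : 1 <= B. Proof. by rewrite /B -!natrM ler1n !muln_gt0 b_gt0 d_gt0. Qed.
Let n1 : 1 <= n%:R :> R. Proof. by rewrite ler1n. Qed.

Let X4 : 4 <= 4 * B * n%:R.
Proof. by have := ler_pM ler01 ler01 B1 n1; rewrite mulr1 -mulrA; lra. Qed.

Let size_log1 : 1 <= size_log.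
Proof.
rewrite (le_trans (ln4_ge1 R))// ler_ln ?posrE//.
by apply: lt_le_trans X4.
Qed.

Let log_delta0 : 0 <= ln (3 / delta).
Proof. by rewrite ln_ge0// ler_pdivlMr// mul1r (le_trans delta_le1)// ler1n. Qed.

Let n0 : 0 < n%:R :> R. Proof. by rewrite ltr0n. Qed.

Let B0 : 0 <= B. Proof. exact: le_trans B1. Qed.
Let size_log0 : 0 <= size_log. Proof. exact: le_trans size_log1. Qed.

Let Tsq : T ^+ 2 = 2 * B * size_log / n%:R.
Proof. by rewrite sqr_sqrtr// divr_ge0// mulr_ge0// mulr_ge0. Qed.

Let Ssq : S ^+ 2 = ln (3 / delta) / (2 * n%:R).
Proof. by rewrite sqr_sqrtr// divr_ge0// mulr_ge0// ltW. Qed.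

Let epssq : eps ^+ 2 = (4 * B * size_log + ln (3 / delta)) / n%:R.
Proof. by rewrite sqr_sqrtr// divr_ge0// addr_ge0// mulr_ge0// mulr_ge0. Qed.

Let Bl1 : 1 <= B * size_log.
Proof. by have := ler_pM ler01 ler01 B1 size_log1; rewrite mulr1. Qed.

Lemma deviation_gt0 : 0 < eps.
Proof.
rewrite sqrtr_gt0 divr_gt0// ltr_pwDl// -mulrA mulr_gt0//; exact: lt_le_trans Bl1.
Qed.

(** Since eps^2 = 2 T^2 + 2 S^2, eps is at most sqrt 2 (T + S), and 10/7 exceeds sqrt 2. The grid
    term is at most 3 / (2n), hence at most 9/8 T, and 40/7 + 9/8 < 7. *)
Lemma deviation_budget :
  3 * ((d * b + k)%:R / (4 * (b * d * k) * n)%:R) + 4 * eps <= 7 * T + 7 * S.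
Proof.
have T0 : 0 <= T by exact: sqrtr_ge0.
have S0 : 0 <= S by exact: sqrtr_ge0.
have eps_le : eps <= 10 / 7 * (T + S).
  have : eps ^+ 2 <= (10 / 7 * (T + S)) ^+ 2.
    have -> : eps ^+ 2 = 2 * T ^+ 2 + 2 * S ^+ 2.
      by rewrite epssq Tsq Ssq; field; rewrite gt_eqF.
    have := mulr_ge0 T0 S0; nra.
  by rewrite ler_pXn2r ?nnegrE ?sqrtr_ge0// mulr_ge0// addr_ge0.
have grid_le : (d * b + k)%:R / (4 * (b * d * k) * n)%:R <= (2 * n%:R)^-1 :> R.
  rewrite ler_pdivrMr ?ltr0n ?muln_gt0 ?b_gt0 ?d_gt0 ?k_gt0//.
  rewrite (_ : (2 * n%:R)^-1 * _ = (2 * (b * d * k))%:R); last first.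
    by rewrite !natrM; field; rewrite gt_eqF.
  rewrite ler_nat mul2n -addnn; apply: leq_add.
    by rewrite mulnC leq_pmulr.
  by rewrite leq_pmull// muln_gt0 b_gt0.
have T_ge : (2 * n%:R)^-1 <= 3 / 8 * T.
  have : ((2 * n%:R)^-1) ^+ 2 <= (3 / 8 * T) ^+ 2.
    rewrite exprMn Tsq -[2 * B * _]mulrA.
    have -> : ((2 * n%:R)^-1) ^+ 2 = (4 * n%:R)^-1 / n%:R :> R.
      by field; rewrite gt_eqF.
    rewrite [leRHS]mulrA ler_pM2r ?invr_gt0//.
    have : (4 * n%:R)^-1 <= 4^-1 :> R.
      by rewrite lef_pV2 ?posrE ?mulr_gt0// ler_peMr.
    move: Bl1; rewrite exprMn exprVn; lra.
  rewrite ler_pXn2r ?nnegrE ?invr_ge0 ?mulr_ge0//; lra.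
lra.
Qed.

(** The product is at most 2/3 delta: the 2 comes from the two-sided tail and the 3 from log(3 /
    delta), which makes the inequality strict. *)
Lemma deviation_probability (M : nat) :
  (M <= (4 * (b * d * k) * n) ^ (2 * (b * d * k)))%N ->
  2 * M%:R ^+ 2 * expR (- (n%:R * eps ^+ 2)) < delta.
Proof.
move=> MB.
pose Y : R := (4 * (b * d * k) * n)%:R; pose m := (2 * (b * d * k))%N.
have YE : Y = 4 * B * n%:R by rewrite /Y /B !natrM; ring.
have Y0 : 0 < Y by rewrite YE; apply: lt_le_trans X4.
have -> : expR (- (n%:R * eps ^+ 2)) = (Y ^+ m ^+ 2)^-1 * (delta / 3).
  rewrite epssq mulrCA divff ?gt_eqF// mulr1 opprD expRD.
  congr (_ * _); rewrite expRN.
    congr (_ ^-1); rewrite -exprM (_ : 4 * B = (m * 2)%:R); last by rewrite /m /B !natrM; ring.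
    by rewrite expRM_natl /size_log -YE lnK.
  by rewrite lnK ?posrE ?divr_gt0// invf_div.
have MY : M%:R <= Y ^+ m by rewrite /Y -natrX ler_nat.
have MY2 : M%:R ^+ 2 <= Y ^+ m ^+ 2 by rewrite lerXn2r ?nnegrE ?exprn_ge0// ltW.
have Ym0 : 0 < Y ^+ m ^+ 2 by rewrite !exprn_gt0.
have MYV : M%:R ^+ 2 / Y ^+ m ^+ 2 <= 1 by rewrite ler_pdivrMr// mul1r.
move: Ym0 MYV; set Z := Y ^+ m ^+ 2 => Z0 MYV.
have -> : 2 * M%:R ^+ 2 * (Z^-1 * (delta / 3)) =
    2 / 3 * delta * (M%:R ^+ 2 / Z) by field; rewrite gt_eqF.
apply: (@le_lt_trans _ _ (2 / 3 * delta * 1)).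
  by rewrite ler_wpM2l// mulr_ge0// ltW.
rewrite mulr1 gtr_pMl//; lra.
Qed.

End sample_size.

(** * The estimator and its error bound *)

Lemma L1_distE (R : realType) (d : nat) (f g : Rd R d -> R) :
  is_pdf (lebesgue_measure_nd R d) f -> is_pdf (lebesgue_measure_nd R d) g ->
  L1_dist f g = (l1 (lebesgue_measure_nd R d) f g)%:E.
Proof.
move=> pf pg; rewrite /L1_dist Lnorm1 /l1 /Rintegral fineK//.
apply: integrable_fin_num => //.
by apply: integrable_dist; exact: is_pdf_integrable.
Qed.

(** The selected function is a finite sum of products of an indicator in the first variable and a
    candidate in the second, which gives joint measurability. *)
Lemma measurable_finite_selection d1 d2 (T1 : measurableType d1) (T2 : measurableType d2)
    (R : realType) (F : finType) (sel : T1 -> F) (f : F -> T2 -> R) :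
  (forall c, measurable [set s | sel s = c]) ->
  (forall c, measurable_fun [set: T2] (f c)) ->
  measurable_fun [set: T1 * T2] (fun z => f (sel z.1) z.2).
Proof.
move=> msel mf.
rewrite (_ : (fun z => _) = fun z => \sum_c \1_[set s | sel s = c] z.1 * f c z.2); last first.
  apply/funext => z; rewrite (bigD1 (sel z.1))//= indicE mem_set// mul1r big1 ?addr0// => c.
  by rewrite indicE eq_sym => /eqP cz; rewrite memNset// mul0r.
apply: measurable_sum => c; apply: measurable_funM.
  by apply: measurableT_comp => //; exact: measurable_indic.
exact: measurableT_comp.
Qed.

Theorem theorem3 (R : realType) (d b k n : nat) (delta : R)
    (d_gt0 : (0 < d)%N) (b_gt0 : (0 < b)%N) (k_gt0 : (0 < k)%N)
    (n_gt0 : (0 < n)%N) (delta_gt0 : 0 < delta) (delta_le1 : delta <= 1) :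
  exists V : n.-tuple (Rd R d) -> Rd R d -> R,
    estimator V /\
    forall (p : Rd R d -> R) (w L : nat -> R),
      cube_pdf p -> NL_spectrum p w L ->
    forall (dO : measure_display) (Omega : measurableType dO)
      (P : probability Omega R) (X : 'I_n -> {RV P >-> Rd R d}),
      iid_with_density X p ->
      (P [set omega |
            (Num.sqrt 3 * d%:R / (2 * b%:R) * \sum_(i < k) w i * L i)%:E
            + 6%:E * (\sum_(k <= i <oo) (w i)%:E)
            + (7 * Num.sqrt (2 * b%:R * d%:R * k%:R
                             * ln (4 * b%:R * d%:R * k%:R * n%:R) / n%:R))%:E
            + (7 * Num.sqrt (ln (3 / delta) / (2 * n%:R)))%:E
            < L1_dist p (V [tuple X i omega | i < n])]
       < delta%:E)%E.

Proof.
pose mu := lebesgue_measure_nd R d.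
(* The grid has [N.+1] cells per coordinate, hence the predecessor. *)
pose N := (4 * (b * d * k) * n).-1.
have NE : N.+1 = (4 * (b * d * k) * n)%N.
  by rewrite /N prednK// !muln_gt0 b_gt0 d_gt0 k_gt0.
have [rep [vrep repP]] := @grid_cover R d b k b_gt0 k_gt0 N.
pose f c := multiview (rep c).
have cube_f c : cube_pdf (f c) by exact: cube_pdf_multiview.
have pdf_f c : is_pdf mu (f c) by have [] := cube_f c.
pose sel : n.-tuple (Rd R d) -> _ := minimum_distance mu f [ffun => ord0].
have msel c : measurable [set s | sel s = c] by exact: measurable_minimum_distance.
exists (fun s => f (sel s)); split.
  split; last by move=> s; exact: cube_f.
  by apply: (measurable_finite_selection (f := f) msel) => c; have [] := pdf_f c.
move=> p w L p_cube [w0 w1 w00 [q [qP pE]]] dO Omega P X [Xind XP].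
have pdf_p : is_pdf mu p by have [] := p_cube.
have [theta vt bias] : exists2 theta : view_index d b k -> R, view_valid theta &
  (\int[mu]_x `|p x - multiview theta x|%:E <=
    2%:E * \sum_(k <= i <oo) (w i)%:E +
    (Num.sqrt 3 / 6 * d%:R / b%:R * \sum_(i < k) w i * L i)%:E)%E.
  apply: (@spectrum_bias R d b k b_gt0 k_gt0 p w L q) => //.
    by move=> i j; have [] := qP i j.
  by move=> i j x y; have [_ /(_ (x, y))] := qP i j; exact.
have pdf_t : is_pdf mu (multiview theta) by have [] := cube_pdf_multiview b_gt0 vt.
have L1E g h : is_pdf mu g -> is_pdf mu h ->
    (\int[mu]_x `|g x - h x|%:E = (l1 mu g h)%:E)%E.
  move=> pg ph; rewrite /l1 /Rintegral fineK//; apply: integrable_fin_num => //.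
  by apply: integrable_dist; exact: is_pdf_integrable.
(* The tail lies between 0 and 1, so it is a real number and the threshold can be handled in R. *)
have tail_ge0 : (0 <= \sum_(k <= i <oo) (w i)%:E)%E.
  by apply: nneseries_ge0 => i _ _; rewrite lee_fin.
have tail_le1 : (\sum_(k <= i <oo) (w i)%:E <= 1)%E.
  rewrite -w1 (@nneseries_split _ _ 0 k)//=; last by move=> i _; rewrite lee_fin.
  by rewrite add0n leeDr// sume_ge0// => i _; rewrite lee_fin.
move: bias tail_ge0 tail_le1; rewrite L1E//.
case: (\sum_(k <= i <oo) (w i)%:E)%E => [r| |]// + _ _.
rewrite -EFinM -EFinD lee_fin => bias.
have := repP theta vt; set c := grid_cell _ _; rewrite L1E//; last exact: pdf_f.
rewrite lee_fin NE => grid.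
set A := Num.sqrt 3 * d%:R / _ * _; set T := Num.sqrt (_ * ln _ / _).
set S := Num.sqrt _.
pose eps := Num.sqrt ((4 * (b%:R * d%:R * k%:R) *
  ln (4 * (b%:R * d%:R * k%:R) * n%:R) + ln (3 / delta)) / n%:R) : R.
rewrite (_ : [set omega | _] =
    [set omega | A + 6 * r + 7 * T + 7 * S < l1 mu p (f (sel [tuple X i omega | i < n]))]%R); last first.
  by apply/funext => omega /=; rewrite L1_distE// -EFinM -!EFinD lte_fin.
apply: le_lt_trans (_ : (_ <= (2 * #|{ffun view_index d b k -> 'I_N.+1}|%:R ^+ 2 *
  expR (- (n%:R * eps ^+ 2)))%:E)%E) _.
  apply: (minimum_distance_tail pdf_f _ (c := c)) => //.
    exact: deviation_gt0.
  (* The factor 3 of the oracle inequality turns the bias of [theta] into the first two terms of the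
     threshold; the grid error and the deviation are covered by [deviation_budget]. *)
  have Ip := is_pdf_integrable pdf_p.
  have := l1_triangle Ip (is_pdf_integrable pdf_t) (is_pdf_integrable (pdf_f c)).
  have := @deviation_budget R d b k n delta d_gt0 b_gt0 k_gt0 n_gt0 delta_gt0 delta_le1.
  rewrite -/eps.
  have -> : Num.sqrt (2 * (b%:R * d%:R * k%:R) *
      ln (4 * (b%:R * d%:R * k%:R) * n%:R) / n%:R) = T.
    by rewrite /T !mulrA.
  have AE : A = 3 * (Num.sqrt 3 / 6 * d%:R / b%:R * \sum_(i < k) w i * L i).
    by rewrite /A; field; rewrite pnatr_eq0 -lt0n.
  rewrite -/S AE; move: bias grid; rewrite -/(f c); lra.
rewrite lte_fin; apply: deviation_probability => //.
rewrite card_ffun card_ord NE leq_pexp2l//; first by rewrite !muln_gt0 b_gt0 d_gt0 k_gt0.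
(* The number k + kdb of parameters is at most 2bdk. *)
rewrite /view_index card_sum !card_prod !card_ord mul2n -addnn.
apply: leq_add; first by rewrite leq_pmull// muln_gt0 b_gt0.
by rewrite (mulnC b) -mulnA mulnC -mulnA leq_mul.
Qed.
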